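(* For the Armstrong–Stump–Thomas bijection $\Theta_W\colon \mathcal{A}(\Phi^+)\to \mathrm{NC}(W,c_Lc_R)$ described below, we have \[\Theta_W \cdot (\mathrm{Row}^{-1} \cdot \mathrm{Rvac}) = \mathrm{Flip}\cdot \Theta_W,\] where $\mathrm{Flip}\colon \mathrm{NC}(W,c_Lc_R)\to\mathrm{NC}(W,c_Lc_R)$ is the involutive poset automorphism defined by $\mathrm{Flip}(w) \coloneqq c_L w^{-1} c_L^{-1}$.
   Context: Let $\Phi$ be a crystallographic root system of rank $r$ with Weyl group $W$, simple roots $\alpha_1,\dots,\alpha_r$, simple reflections $s_1,\dots,s_r$, and root poset $\Phi^+$ (positive roots, with $\alpha\le\beta$ iff $\beta-\alpha$ is a nonnegative sum of simple roots); this poset is ranked by $\mathrm{rk}(\alpha)=\mathrm{height}(\alpha)-1$. Let $\mathcal{A}(\Phi^+)$ be the set of antichains of $\Phi^+$ (the $W$-nonnesting partitions). For a ranked poset $P$ and $p\in P$, the toggle $\tau_p$ on antichains removes $p$ if $p\in A$, adds $p$ if $p\notin A$ and $A\cup\{p\}$ is an antichain, and otherwise does nothing; the rank toggle $\boldsymbol{\tau}_i$ is the product of $\tau_p$ over all $p$ of rank $i$. Rowmotion is $\mathrm{Row}=\boldsymbol{\tau}_{\mathrm{rk}(P)}\cdots\boldsymbol{\tau}_0$ (equivalently $\mathrm{Row}(A)=\min\{x\in P: x\not\le y \text{ for all } y\in A\}$), and rowvacuation is $\mathrm{Rvac}=(\boldsymbol{\tau}_{\mathrm{rk}(P)})(\boldsymbol{\tau}_{\mathrm{rk}(P)}\boldsymbol{\tau}_{\mathrm{rk}(P)-1})\cdots(\boldsymbol{\tau}_{\mathrm{rk}(P)}\cdots\boldsymbol{\tau}_0)$.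 Fix a bipartition $L\sqcup R=[r]$ of the Dynkin diagram, let $c_X=\prod_{i\in X}s_i$, and let $c=c_Lc_R$ be the bipartite Coxeter element. Let $T$ be the set of reflections, $\ell_T$ the absolute length, absolute order $u\le w$ iff $\ell_T(w)=\ell_T(u)+\ell_T(u^{-1}w)$, and $\mathrm{NC}(W,c)$ the interval $[e,c]$ in absolute order (the $W$-noncrossing partitions). The Kreweras complement is $\mathrm{Krew}(w)=cw^{-1}$. For $J\subseteq[r]$, $W_J$ is the parabolic subgroup generated by $s_i$, $i\in J$, and for an antichain $A$, $\mathrm{supp}(A)=\{i: \alpha_i\le\alpha \text{ for some }\alpha\in A\}$. By Armstrong–Stump–Thomas, $\Theta_W\colon\mathcal{A}(\Phi^+)\to\mathrm{NC}(W,c_Lc_R)$ is the unique bijection such that: $\Theta_W(\{\alpha_i: i\in L\})=e$; $\Theta_W\cdot\mathrm{Row}=\mathrm{Krew}\cdot\Theta_W$; and $\Theta_W(A)=\prod_{i\in L\setminus\mathrm{supp}(A)}s_i\cdot\Theta_{W_{\mathrm{supp}(A)}}(A)$ (parabolic induction, with $\mathrm{NC}(W_{\mathrm{supp}(A)},c_{L\cap\mathrm{supp}(A)}c_{R\cap\mathrm{supp}(A)})\subseteq\mathrm{NC}(W,c_Lc_R)$). *)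

(* Defs.v *)
From mathcomp Require Import all_boot all_order all_algebra.

Set Implicit Arguments.
Unset Strict Implicit.
Unset Printing Implicit Defensive.

Import Order.TTheory GRing.Theory Num.Theory.
Local Open Scope ring_scope.

(** * Antichain toggles of a finite ranked poset

  A finite poset is a subset [P] of a finite type ordered by [le], with rank
  function [rk]. *)

Section Toggles.
Variables (T : finType) (le : rel T).
Implicit Types (P A B : {set T}) (rk : T -> nat).

Definition antichain A := [forall x in A, forall y in A, le x y ==> (x == y)].

Definition antichains P : {set {set T}} :=
  [set A : {set T} | (A \subset P) && antichain A].

Definition toggle (p : T) A : {set T} :=
  if p \in A then A :\ p
  else if antichain (p |: A) then p |: A else A.

(* Toggles at incomparable elements commute, so the enumeration order of the
   elements of rank [i] is irrelevant. *)
Definition rank_toggle P rk (i : nat) A : {set T} :=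
  foldr toggle A [seq p <- enum P | rk p == i].

Definition poset_rank P rk : nat := (\max_(p in P) rk p)%N.

(* tau_rk(P) ... tau_(i+1) tau_i, where tau_i acts first. *)
Definition toggles_from P rk (i : nat) A : {set T} :=
  foldl (fun B j => rank_toggle P rk j B) A
    (iota i ((poset_rank P rk).+1 - i)).

Definition rowmotion P rk A : {set T} := toggles_from P rk 0 A.

(* (tau_rk)(tau_rk tau_(rk-1)) ... (tau_rk ... tau_0), the last factor acting
   first. *)
Definition rowvacuation P rk A : {set T} :=
  foldl (fun B i => toggles_from P rk i B) A (iota 0 (poset_rank P rk).+1).

Lemma antichainS A B : A \subset B -> antichain B -> antichain A.
Proof.
move=> /subsetP sAB /forall_inP aB; apply/forall_inP => x /sAB xB.
by apply/forall_inP => y /sAB; apply: (forall_inP (aB x xB)).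
Qed.

Lemma toggle_antichains P p :
  p \in P -> {homo toggle p : A / A \in antichains P}.
Proof.
move=> pP A; rewrite !inE => /andP[sAP aA]; rewrite /toggle.
case: ifP => _; last case: ifP => aU; last by rewrite sAP aA.
- by rewrite (subset_trans (subD1set _ _) sAP) (antichainS (subD1set _ _) aA).
- by rewrite aU subUset sub1set pP sAP.
Qed.

Lemma toggleK P p : {in antichains P, involutive (toggle p)}.
Proof.
move=> A; rewrite inE => /andP[_ aA]; rewrite /toggle.
have [pA|pNA] := boolP (p \in A); first by rewrite setD11 setD1K // aA.
by have [aU|/negPf aU] := boolP (antichain (p |: A));
  [rewrite setU11 setU1K | rewrite (negPf pNA) aU].
Qed.

Lemma rank_toggle_antichains P rk i :
  {homo rank_toggle P rk i : A / A \in antichains P}.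
Proof.
rewrite /rank_toggle => A PA.
have: all [in P] [seq p <- enum P | rk p == i].
  by apply/allP => p; rewrite mem_filter mem_enum => /andP[].
by elim: (filter _ _) => //= p s IHs /andP[pP /IHs]; apply: toggle_antichains.
Qed.

Lemma rank_toggle_inj P rk i :
  {in antichains P &, injective (rank_toggle P rk i)}.
Proof.
rewrite /rank_toggle => A B PA PB.
have: all [in P] [seq p <- enum P | rk p == i].
  by apply/allP => p; rewrite mem_filter mem_enum => /andP[].
elim: (filter _ _) => //= p s IHs /andP[pP sP].
have sin C : C \in antichains P -> foldr toggle C s \in antichains P.
  move=> PC; elim: (s) sP => //= q t IHt /andP[qP /IHt].
  exact: toggle_antichains.
by move=> /(can_in_inj (@toggleK P p) (sin _ PA) (sin _ PB)) /(IHs sP).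
Qed.

Lemma rowmotion_antichains P rk :
  {homo rowmotion P rk : A / A \in antichains P}.
Proof.
move=> A; rewrite /rowmotion /toggles_from.
elim: (iota _ _) A => //= j s IHs A PA.
exact/IHs/rank_toggle_antichains.
Qed.

Lemma rowmotion_inj P rk : {in antichains P &, injective (rowmotion P rk)}.
Proof.
move=> A B; rewrite /rowmotion /toggles_from.
elim: (iota _ _) A B => //= j s IHs A B PA PB /IHs.
rewrite !rank_toggle_antichains // => /(_ isT isT).
exact: rank_toggle_inj.
Qed.

(* [rowmotion] permutes the antichains of [P] (but need not be injective on
   all of [{set T}]); on antichains its inverse is [finv]. *)
Definition rowmotion_inv P rk : {set T} -> {set T} := finv (rowmotion P rk).

Lemma rowmotion_inv_antichains P rk :
  {homo rowmotion_inv P rk : A / A \in antichains P}.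
Proof. exact/finv_in/rowmotion_antichains. Qed.

Lemma rowmotionK P rk :
  {in antichains P, cancel (rowmotion P rk) (rowmotion_inv P rk)}.
Proof. exact: finv_f_in (@rowmotion_antichains P rk) (@rowmotion_inj P rk). Qed.

Lemma rowmotion_invK P rk :
  {in antichains P, cancel (rowmotion_inv P rk) (rowmotion P rk)}.
Proof. exact: f_finv_in (@rowmotion_antichains P rk) (@rowmotion_inj P rk). Qed.

End Toggles.

(** * Root systems in the Euclidean space K^n of column vectors

  A root system is not required to span the ambient space; its rank is the
  number [r] of simple roots. *)

Section RootSystems.
Variables (K : archiRealFieldType) (n : nat).
Notation V := 'cV[K]_n.

Definition dot (u v : V) : K := (u^T *m v) 0 0.

(* The matrix of v |-> v - 2 (b, v) / (b, b) b, acting by [*m] on the left. *)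
Definition reflection (b : V) : 'M[K]_n :=
  1%:M - (2 / dot b b) *: (b *m b^T).

Record root_system (Phi : seq V) : Prop := RootSystem {
  root_neq0 : 0 \notin Phi;
  root_reflection : {in Phi &, forall a b, reflection a *m b \in Phi};
  root_crystallographic :
    {in Phi &, forall a b, 2 * dot a b / dot a a \is a Num.int};
  root_reduced :
    forall (a : V) (k : K), a \in Phi -> k *: a \in Phi -> k = 1 \/ k = -1
}.

Variable r : nat.

Record simple_system (Phi : seq V) (alpha : r.-tuple V) : Prop := SimpleSystem {
  simple_root : {subset alpha <= Phi};
  simple_free : free alpha;
  simple_sign : forall b : V, b \in Phi -> exists m : 'I_r -> nat,
    b = \sum_i (m i)%:R *: tnth alpha i \/
    b = - \sum_i (m i)%:R *: tnth alpha i
}.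

Variables (Phi : seq V) (alpha : r.-tuple V).

(* [coord alpha i v] is the coefficient of the i-th simple root in [v], for [v]
   in the span of [alpha], in particular for [v] a root or a difference of
   roots. *)
Definition nonneg_simple_sum (v : V) : bool :=
  [forall i, coord alpha i v \is a Num.nat].

Definition root_le (u v : V) : bool := nonneg_simple_sum (v - u).

(* Used only for positive roots, whose coordinates are natural numbers. *)
Definition height (v : V) : nat := (\sum_i Num.truncn (coord alpha i v))%N.

Notation root := (seq_sub Phi).

Definition le_root : rel root := fun a b => root_le (val a) (val b).

Definition root_rank (b : root) : nat := (height (val b)).-1.

(** For [J : {set 'I_r}], the parabolic subgroup W_J generated by the simple
  reflections indexed by [J] is the Weyl group of the root system Phi_J of the
  roots in the span of the corresponding simple roots; all W_J live in the same
  matrix space, and [J = setT] gives Phi and W. *)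

Implicit Types (J X L R : {set 'I_r}) (A : {set root}) (u w : 'M[K]_n).

Definition parabolic_roots J : {set root} :=
  [set b : root | val b \in <<[seq tnth alpha i | i in J]>>%VS].

Definition root_poset J : {set root} :=
  [set b in parabolic_roots J | nonneg_simple_sum (val b)].

Definition simple_roots X : {set root} :=
  [set b : root | [exists i in X, val b == tnth alpha i]].

Definition supp A : {set 'I_r} :=
  [set i | [exists a in A, root_le (tnth alpha i) (val a)]].

Definition nonnesting J : {set {set root}} :=
  antichains le_root (root_poset J).

Definition Row J : {set root} -> {set root} :=
  rowmotion le_root (root_poset J) root_rank.

Definition Row_inv J : {set root} -> {set root} :=
  rowmotion_inv le_root (root_poset J) root_rank.

Definition Rvac J : {set root} -> {set root} :=
  rowvacuation le_root (root_poset J) root_rank.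

Definition dynkin_edge (i j : 'I_r) : bool :=
  (i != j) && (dot (tnth alpha i) (tnth alpha j) != 0).

Record dynkin_bipartition L R : Prop := DynkinBipartition {
  bipart_cover : L :|: R = setT;
  bipart_disjoint : [disjoint L & R];
  bipart_left : {in L &, forall i j, ~~ dynkin_edge i j};
  bipart_right : {in R &, forall i j, ~~ dynkin_edge i j}
}.

Definition simple_refl (i : 'I_r) : 'M[K]_n := reflection (tnth alpha i).

Definition weyl J w : Prop :=
  exists2 s : seq 'I_r, {subset s <= J} &
    w = \big[mulmx/1%:M]_(i <- s) simple_refl i.

(* [w] is a product of [k] reflections of W_J. *)
Definition reflection_product J (k : nat) w : Prop :=
  exists t : seq root,
    [/\ size t = k, {subset t <= parabolic_roots J} &
        w = \big[mulmx/1%:M]_(b <- t) reflection (val b)].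

Definition abs_length J w (k : nat) : Prop :=
  reflection_product J k w /\
  forall m, reflection_product J m w -> (k <= m)%N.

(* l_T(w) = l_T(u) + l_T(u^-1 w), the absolute length being encoded as the
   functional relation [abs_length]. *)
Definition abs_le J u w : Prop :=
  exists k l : nat,
    [/\ abs_length J u k, abs_length J (invmx u *m w) l &
        abs_length J w (k + l)].

(* The order of the factors is irrelevant for [X] included in [L] or [R], as
   the simple reflections indexed by [X] then commute. *)
Definition cox_part X : 'M[K]_n := \big[mulmx/1%:M]_(i in X) simple_refl i.

Definition coxeter L R J : 'M[K]_n :=
  cox_part (L :&: J) *m cox_part (R :&: J).

Definition noncrossing L R J w : Prop :=
  [/\ weyl J w, abs_le J 1%:M w & abs_le J w (coxeter L R J)].

Definition Krew L R J w : 'M[K]_n := coxeter L R J *m invmx w.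

Definition Flip L w : 'M[K]_n :=
  cox_part L *m invmx w *m invmx (cox_part L).

(** The Armstrong-Stump-Thomas bijections Theta_(W_J), for all the parabolic
  subgroups of W at once; [Theta setT] is Theta_W.  The family is unique on
  nonnesting partitions; the values [Theta J A] for [A] not in [nonnesting J]
  are irrelevant. *)
Record AST_family L R (Theta : {set 'I_r} -> {set root} -> 'M[K]_n) : Prop :=
  ASTFamily {
    AST_noncrossing : forall J A,
      A \in nonnesting J -> noncrossing L R J (Theta J A);
    AST_injective : forall J, {in nonnesting J &, injective (Theta J)};
    AST_surjective : forall J w, noncrossing L R J w ->
      exists2 A, A \in nonnesting J & Theta J A = w;
    AST_initial : forall J, Theta J (simple_roots (L :&: J)) = 1%:M;
    AST_equivariant : forall J A, A \in nonnesting J ->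
      Theta J (Row J A) = Krew L R J (Theta J A);
    AST_parabolic : forall J A, A \in nonnesting J ->
      Theta J A =
        cox_part ((L :&: J) :\: supp A) *m Theta (supp A) A
  }.

Definition involutive_poset_automorphism (S : 'M[K]_n -> Prop)
    (le : 'M[K]_n -> 'M[K]_n -> Prop) (f : 'M[K]_n -> 'M[K]_n) : Prop :=
  [/\ forall w, S w -> S (f w),
      forall w, S w -> f (f w) = w &
      forall u w, S u -> S w -> (le u w <-> le (f u) (f w))].

End RootSystems.

(* Main.v *)
(* Encoding an antichain by the order ideal it generates turns the rank toggle
   tau_i into (t_0 ... t_(i-1)) t_i (t_(i-1) ... t_0), where t_i toggles the
   elements of rank i of an ideal. Hence Row = t_0 ... t_N and
   psi := Row^-1 Rvac = (t_N) (t_(N-1) t_N) ... (t_1 ... t_N). Since t_i and t_j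
   commute for |i - j| > 1, Row psi Row = psi; since psi never toggles rank 0, it
   preserves supports and commutes with the passage to a parabolic subsystem.

   On the noncrossing side Krew Flip Krew = Flip, and Flip is compatible with
   parabolic induction, so by induction on the rank it is enough that every orbit
   of Row on the antichains of Phi_J contains an antichain of smaller support.
   If w < c in absolute order then w <= c t for some reflection t, and Krew^2 is
   conjugation by c. Some c^m turns the root of t into an inversion of c, i.e.
   into alpha_j with j in R or c_R alpha_i with i in L; then c t becomes the
   Coxeter element of a maximal parabolic subgroup W_(J - i), and the roots of a
   reduced factorisation of it span the orthogonal of its fixed space, which puts
   the conjugate of w in NC(W_(J - i)). *)
Require Import Defs.
From mathcomp Require Import all_boot all_order all_algebra.

Set Implicit Arguments.
Unset Strict Implicit.
Unset Printing Implicit Defensive.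

Import Order.TTheory GRing.Theory Num.Theory.

(** * Toggles of order ideals *)

Section IdealToggles.
Variables (T : finType) (le : rel T).
Implicit Types (P Q A B I X Y : {set T}) (rk : T -> nat).

(** Ideals are the right encoding because antichain toggles at comparable elements need not commute,
    however far apart their ranks are; on ideals of a graded poset only adjacent ranks interact. The
    relation Row psi Row = psi carries the claim from Row A back to A: Theta (psi A) = Theta (Row
    psi Row A) = Krew Flip Krew (Theta A) = Flip (Theta A). So one settled member settles its whole
    orbit, and psi never has to be computed on antichains of full support.

    Two points of the descent to W_(J - i) do not come from conjugation alone. The element w = c
    leaves no reflection to split off, but one Row moves it to e. And Theta_W puts s_i in front when
    i is in L and outside the support, so for such i the antichain found in Phi_(J - i) is not the
    one reached by an even power of Row; one more Row absorbs the factor, because c = s_i c_(J - i).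

    A subsystem may have a smaller top rank than the whole system, so the words in ideal toggles
    carry their own top rank N, and the surplus toggles are shown to be trivial. *)

Definition lt_of x y := le x y && (x != y).

Definition order_ideal P I : Prop :=
  I \subset P /\ {in P & I, forall x y, le x y -> x \in I}.

Definition down_closure P A := [set x in P | [exists a in A, le x a]].

(** Toggling all of rank [i] simultaneously is the product of the single toggles: when [rk] is
    strictly increasing, whether one of these elements can be added or removed depends on other
    ranks only. *)
Definition ideal_toggle P rk i I :=
  [set x in P | if rk x == i then
                  if x \in I then [exists y in I, lt_of x y]
                  else [forall z in P, lt_of z x ==> (z \in I)]
                else x \in I].

(* The word t_i t_(i+1) ... t_N in the ideal toggles, t_N acting first. *)
Definition ideal_toggles P rk N i I :=
  foldr (ideal_toggle P rk) I (iota i (N.+1 - i)).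

(* (t_N) (t_(N-1) t_N) ... (t_i ... t_N), the last factor acting first. *)
Definition ideal_vacuation P rk N i I :=
  foldl (fun X k => ideal_toggles P rk N k X) I (iota i (N.+1 - i)).

Section Poset.
Variables (P : {set T}) (rk : T -> nat).
Hypothesis le_refl : reflexive le.
Hypothesis le_anti : antisymmetric le.
Hypothesis le_trans : transitive le.
Hypothesis rk_lt : {in P &, forall x y, lt_of x y -> rk x < rk y}.

Local Notation lt := lt_of.
Local Notation t := (ideal_toggle P rk).
Local Notation D := (down_closure P).

Lemma lt_of_trans : transitive lt.
Proof.
move=> y x z /andP[xy nxy] /andP[yz nyz]; rewrite /lt_of (le_trans xy yz) /=.
apply: contra nxy => /eqP exz; subst z.
by apply/eqP/le_anti; rewrite xy yz.
Qed.

Lemma down_closure_ideal A : order_ideal P (D A).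
Proof.
split; first by apply/subsetP => x; rewrite inE => /andP[].
move=> x y xP; rewrite !inE xP /= => /andP[_ /exists_inP[a aA ya]] xy.
by apply/exists_inP; exists a => //; apply: le_trans ya.
Qed.

(** An antichain is the set of maximal elements of its ideal: in a <= b <= a' with a, a' in [A] and
    b in [B], the ends agree, hence a = b. *)
Lemma down_closure_inj : {in antichains le P &, injective D}.
Proof.
suff sub A B : A \in antichains le P -> B \in antichains le P ->
    D A = D B -> A \subset B.
  move=> A B PA PB eD; apply/eqP.
  by rewrite eqEsubset (sub A B) // (sub B A).
rewrite !inE => /andP[/subsetP sA /forall_inP aA] /andP[/subsetP sB _] eD.
apply/subsetP => a aInA.
have : a \in D A.
  by rewrite inE sA //=; apply/exists_inP; exists a; rewrite ?le_refl.
rewrite eD inE => /andP[_ /exists_inP[b bB ab]].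
have : b \in D B.
  by rewrite inE sB //=; apply/exists_inP; exists b; rewrite ?le_refl.
rewrite -eD inE => /andP[_ /exists_inP[a' a'A ba']].
have /implyP/(_ (le_trans ab ba'))/eqP e := forall_inP (aA a aInA) a' a'A.
by rewrite -e in ba'; rewrite (_ : a = b) //; apply: le_anti; rewrite ab.
Qed.

Lemma ideal_toggle_ideal i I : order_ideal P I -> order_ideal P (t i I).
Proof.
move=> [/subsetP sI dI]; split; first by apply/subsetP => x; rewrite inE => /andP[].
move=> x y xP yt xy; have [->//|nxy] := eqVneq x y.
have ltxy : lt x y by rewrite /lt_of xy.
move: yt; rewrite !inE xP => /andP[yP] yt /=.
have rxy := rk_lt xP yP ltxy.
have xI : x \in I.
  case: eqP yt => [_|_ yI]; last exact: dI yI xy.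
  case: ifP => [yI _|_ /forall_inP/(_ x xP)/implyP/(_ ltxy)] //.
  exact: dI yI xy.
rewrite xI; case: eqP => // ri; move: yt.
rewrite -ri gtn_eqF // => yI.
by apply/exists_inP; exists y.
Qed.

(** Downward closure makes the two tests complementary: an element just removed has everything below
    it in [I], and one just added has nothing above it in [I]. *)
Lemma ideal_toggleK i I : order_ideal P I -> t i (t i I) = I.
Proof.
move=> ideal_I; have [/subsetP sI dI] := ideal_I.
have idE x : rk x != i -> x \in P -> (x \in t i I) = (x \in I).
  by move=> ri xP; rewrite inE xP (negPf ri).
apply/setP => x; rewrite inE.
have [xP|xNP] := boolP (x \in P); last by apply/esym/negP => /sI; apply/negP.
case: eqP => [ri|/eqP ri]; last by rewrite idE.
rewrite /=; have [xI|xNI] := boolP (x \in I); last first.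
  have [xt|xNt] := boolP (x \in t i I).
    apply/exists_inP => -[y yt ltxy].
    have yP : y \in P by move: yt; rewrite inE => /andP[].
    have ry : rk y != i by rewrite -ri gtn_eqF // rk_lt.
    move: yt; rewrite idE // => yI; move/negP: xNI; apply.
    by apply: dI yI _ => //; case/andP: ltxy.
  apply: contraNF xNt => /forall_inP H.
  rewrite inE xP ri eqxx (negPf xNI); apply/forall_inP => z zP.
  apply/implyP => ltzx; rewrite -idE //; first exact: (implyP (H z zP)).
  by rewrite -ri ltn_eqF // rk_lt.
have [xt|xNt] := boolP (x \in t i I).
  move: xt; rewrite inE xP ri eqxx xI /= => /exists_inP[y yI ltxy].
  apply/exists_inP; exists y => //; rewrite idE ?sI //.
  by rewrite -ri gtn_eqF // rk_lt ?sI.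
apply/forall_inP => z zP; apply/implyP => ltzx.
rewrite idE //; last by rewrite -ri ltn_eqF // rk_lt.
by apply: dI xI _ => //; case/andP: ltzx.
Qed.

Lemma foldr_ideal_toggle_ideal s I :
  order_ideal P I -> order_ideal P (foldr t I s).
Proof. by move=> idI; elim: s => //= i s; apply: ideal_toggle_ideal. Qed.

Lemma foldr_foldl_ideal_toggle s I :
  order_ideal P I -> foldr t (foldl (fun X i => t i X) I s) s = I.
Proof.
elim: s I => //= i s IHs I idI.
by rewrite IHs ?ideal_toggleK //; apply: ideal_toggle_ideal.
Qed.

Lemma foldr_ideal_toggle_inj s I I' :
  order_ideal P I -> order_ideal P I' -> foldr t I s = foldr t I' s -> I = I'.
Proof.
move=> idI idI'; elim: s => //= i s IHs /(congr1 (t i)).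
by rewrite !ideal_toggleK //; apply: foldr_ideal_toggle_ideal.
Qed.

(** * Commutation of distant ranks and the dihedral relation *)

Section Dihedral.
Hypothesis graded : {in P &, forall x y, lt x y -> (rk x).+1 < rk y ->
  exists2 z, z \in P & lt x z && lt z y}.

(** The tests look at all comparable elements, not only at covers. Gradedness replaces a witness in
    the other toggled rank by an element of strictly intermediate rank, whose membership neither
    toggle changes. *)
Lemma ideal_toggleC i j I : i.+1 < j -> order_ideal P I ->
  t i (t j I) = t j (t i I).
Proof.
move=> ij idI; have [/subsetP sI dI] := idI.
have nij : i != j by rewrite ltn_eqF // ltnW.
have [_ dj] := ideal_toggle_ideal j idI.
have [_ di] := ideal_toggle_ideal i idI.
have lt_le x y : lt x y -> le x y by case/andP.
have idE k x : rk x != k -> x \in P -> (x \in t k I) = (x \in I).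
  by move=> rx xP; rewrite inE xP (negPf rx).
have tP k x : x \in t k I -> x \in P by rewrite inE => /andP[].
apply/setP => x; rewrite inE [RHS]inE; case xP: (x \in P) => //=.
have [ri|ri] := eqVneq (rk x) i.
  rewrite ri (negPf nij) idE ?ri // [x \in t i I]inE xP ri eqxx /=.
  case: ifP => xI.
    apply/exists_inP/exists_inP => -[y yI ltxy].
      have yP := tP _ _ yI.
      have [rj|rj] := eqVneq (rk y) j; last by exists y => //; rewrite -(idE j).
      have [|z zP /andP[xz zy]] := graded xP yP ltxy; first by rewrite ri rj.
      exists z => //; rewrite -(idE j) //; last by rewrite -rj ltn_eqF // rk_lt.
      by apply: dj yI _ => //; apply: lt_le.
    have yP := sI _ yI.
    have [rj|rj] := eqVneq (rk y) j; last by exists y => //; rewrite idE.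
    have [|z zP /andP[xz zy]] := graded xP yP ltxy; first by rewrite ri rj.
    exists z => //; rewrite idE //; last by rewrite -rj ltn_eqF // rk_lt.
    by apply: dI yI _ => //; apply: lt_le.
  apply/forall_inP/forall_inP => H z zP; apply/implyP => ltzx;
    have /implyP/(_ ltzx) := H z zP; rewrite idE //;
    rewrite ltn_eqF //; apply: leq_trans (rk_lt zP xP ltzx) _; rewrite ri;
    exact/ltnW/ltnW.
have [rj|rj] := eqVneq (rk x) j; last by rewrite !idE.
rewrite (idE i) // [x \in t j I]inE xP rj eqxx /=.
case: ifP => xI.
  have ry y : y \in P -> lt x y -> rk y != i.
    move=> yP ltxy; rewrite gtn_eqF //; apply: leq_trans (rk_lt xP yP ltxy).
    by rewrite rj; apply/leqW/ltnW.
  apply/exists_inP/exists_inP => -[y yI ltxy]; exists y => //.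
    by rewrite idE ?ry ?sI.
  by rewrite -(idE i) ?ry // (tP i).
apply/forall_inP/forall_inP => H z zP; apply/implyP => ltzx;
    have /implyP/(_ ltzx) zI := H z zP; have [rz|rz] := eqVneq (rk z) i.
- have [|y yP /andP[zy yx]] := graded zP xP ltzx; first by rewrite rz rj.
  rewrite inE zP rz eqxx zI /=; apply/exists_inP; exists y => //.
  exact: (implyP (H y yP)).
- by rewrite idE.
- have [|y yP /andP[zy yx]] := graded zP xP ltzx; first by rewrite rz rj.
  apply: (dI z y) => //; last exact: lt_le.
  rewrite -(idE i) //; first exact: (implyP (H y yP)).
  by rewrite -rz gtn_eqF // rk_lt.
- by rewrite -(idE i).
Qed.

Lemma foldr_ideal_toggleC i s I : all (fun j => i.+1 < j) s ->
  order_ideal P I -> foldr t (t i I) s = t i (foldr t I s).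
Proof.
move=> + idI; elim: s => //= j s IHs /andP[ij /IHs ->].
by rewrite (ideal_toggleC ij) //; apply: foldr_ideal_toggle_ideal.
Qed.

Lemma ideal_toggles_ideal N i I :
  order_ideal P I -> order_ideal P (ideal_toggles P rk N i I).
Proof. exact: foldr_ideal_toggle_ideal. Qed.

Lemma ideal_vacuation_ideal N i I :
  order_ideal P I -> order_ideal P (ideal_vacuation P rk N i I).
Proof.
rewrite /ideal_vacuation; elim: (iota _ _) I => //= k s IHs I idI.
exact/IHs/ideal_toggles_ideal.
Qed.

Lemma ideal_vacuationC N i j I : i.+1 < j -> order_ideal P I ->
  ideal_vacuation P rk N j (t i I) = t i (ideal_vacuation P rk N j I).
Proof.
move=> ij; rewrite /ideal_vacuation.
have : all (fun k => i.+1 < k) (iota j (N.+1 - j)).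
  by apply/allP => k; rewrite mem_iota => /andP[jk _]; apply: leq_trans jk.
elim: (iota _ _) I => //= k s IHs I /andP[ik /IHs{}IHs] idI.
rewrite /ideal_toggles foldr_ideal_toggleC ?IHs //.
  exact: foldr_ideal_toggle_ideal.
by apply/allP => l; rewrite mem_iota => /andP[kl _]; apply: leq_trans kl.
Qed.

(** Write W_i for [ideal_toggles] and V_i for [ideal_vacuation] from rank i. The right side is
    W_i^-1 V_(i+1), while V_i = V_(i+1) W_i by definition; for i = 0 this says psi Row = Row^-1 psi.
    Downward induction: V_(i+1) t_i W_(i+1) = W_(i+1)^-1 V_(i+2) t_i W_(i+1), and t_i commutes with
    V_(i+2), which leaves W_(i+1)^-1 t_i V_(i+1). *)
Lemma ideal_vacuation_dihedral N i I : order_ideal P I ->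
  ideal_vacuation P rk N i I =
  foldl (fun X k => t k X) (ideal_vacuation P rk N i.+1 I) (iota i (N.+1 - i)).
Proof.
have step k : k <= N -> iota k (N.+1 - k) = k :: iota k.+1 (N.+1 - k.+1).
  by move=> kN; rewrite subSn.
move: {2}(N.+1 - i) (erefl (N.+1 - i)) => d; elim: d i I => [|d IHd] i I ed idI.
  by rewrite /ideal_vacuation ed subnS ed.
have iN : i <= N by rewrite -ltnS -subn_gt0 ed.
have ed' : N.+1 - i.+1 = d by rewrite subnS ed.
have vacS X : ideal_vacuation P rk N i X =
    ideal_vacuation P rk N i.+1 (ideal_toggles P rk N i X).
  by rewrite {1}/ideal_vacuation step.
have togS X : ideal_toggles P rk N i X = t i (ideal_toggles P rk N i.+1 X).
  by rewrite {1}/ideal_toggles step.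
have idW X : order_ideal P X -> order_ideal P (ideal_toggles P rk N i.+1 X).
  exact: ideal_toggles_ideal.
rewrite vacS togS IHd //; last exact/ideal_toggle_ideal/idW.
rewrite ideal_vacuationC ?(step i iN) //=; last exact: idW.
congr (foldl _ (t i _) _).
case: (ltnP i N) => [iN'|Ni].
  by rewrite [in RHS]/ideal_vacuation (subSn iN').
by rewrite /ideal_vacuation /ideal_toggles (eqP (_ : N.+1 - i.+1 == 0)) // subnS
   (eqP (_ : N.+1 - i.+1 == 0)).
Qed.

End Dihedral.

(** * Antichain toggles read on the generated ideals *)

Lemma mem_foldr_toggle A s : A \in antichains le P ->
    uniq s -> {subset s <= P} -> {in s &, forall x y, rk x = rk y} ->
  forall x, (x \in foldr (toggle le) A s) =
    if x \in s then (x \notin A) && [forall y in A, ~~ le x y && ~~ le y x]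
    else x \in A.
Proof.
move=> PA; elim: s => //= p s IHs /andP[ps us] sP srk x.
have pP : p \in P by apply: sP; rewrite mem_head.
have {}IHs := IHs us (fun y ys => sP y (mem_behead (s := p :: s) ys))
  (fun y z ys zs => srk y z (mem_behead (s := p :: s) ys) (mem_behead (s := p :: s) zs)).
set C := foldr _ _ _ in IHs *.
have CP : C \in antichains le P.
  rewrite /C; elim: (s) (fun y ys => sP y (mem_behead (s := p :: s) ys)) => //= q u IHu uP.
  apply: toggle_antichains; first by apply: uP; rewrite mem_head.
  by apply: IHu => y yu; apply: uP; rewrite inE yu orbT.
(* Elements of equal rank are incomparable, so the toggles along [s] do not see one another and each
   is decided by [A] alone. *)
have incomp q : q \in s -> ~~ le p q && ~~ le q p.
  move=> qs; have qP : q \in P by apply: sP; rewrite inE qs orbT.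
  have npq : p != q by apply: contraNneq ps => ->.
  have e : rk p = rk q by apply: srk; rewrite ?mem_head // inE qs orbT.
  apply/andP; split; apply/negP => h.
    by have := rk_lt pP qP; rewrite /lt_of h npq e ltnn => /(_ isT).
  by have := rk_lt qP pP; rewrite /lt_of h eq_sym npq e ltnn => /(_ isT).
have pC : (p \in C) = (p \in A) by rewrite IHs (negPf ps).
have aC : p \notin C -> antichain le (p |: C) =
    [forall y in A, ~~ le p y && ~~ le y p].
  move=> pNC; move: CP; rewrite inE => /andP[_ /forall_inP aC].
  apply/forall_inP/forall_inP => H y.
    move=> yA; have [ys|ys] := boolP (y \in s); first exact: incomp.
    have yC : y \in C by rewrite IHs (negPf ys).
    have npy : p != y by apply: contraNneq pNC => ->.
    have /forall_inP/(_ y) := H p (setU11 _ _).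
    rewrite inE yC orbT (negPf npy) => /(_ isT); rewrite implybF => -> /=.
    have /forall_inP/(_ p) := H y (setU1r _ yC).
    by rewrite setU11 eq_sym (negPf npy) implybF => /(_ isT).
  have pz z : z \in C -> ~~ le p z && ~~ le z p.
    move=> zC; have [zs|zs] := boolP (z \in s); first exact: incomp.
    by apply: H; move: zC; rewrite IHs (negPf zs).
  rewrite inE in_set1 => /orP[/eqP->|yC]; apply/forall_inP => z;
    rewrite inE in_set1 => /orP[/eqP->|zC].
  - by rewrite eqxx implybT.
  - by case/andP: (pz z zC) => /negPf->.
  - by case/andP: (pz y yC) => _ /negPf->.
  - exact: (forall_inP (aC y yC)).
rewrite /toggle inE; have [->|nxp] := eqVneq x p.
  rewrite pC; have [pA|pNA] := boolP (p \in A); first by rewrite setD11.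
  rewrite aC ?pC //; case: ifP => /= _; first by rewrite setU11.
  by rewrite pC (negPf pNA).
rewrite -IHs; case: ifP => _; last case: ifP => _ //.
  by rewrite in_setD1 nxp.
by rewrite in_setU1 (negPf nxp).
Qed.

Lemma mem_rank_toggle A i : A \in antichains le P -> forall x,
  (x \in rank_toggle le P rk i A) =
    if (rk x == i) && (x \in P)
    then (x \notin A) && [forall y in A, ~~ le x y && ~~ le y x]
    else x \in A.
Proof.
move=> PA x; rewrite mem_foldr_toggle //.
- by rewrite mem_filter mem_enum.
- by rewrite filter_uniq // enum_uniq.
- by move=> y; rewrite mem_filter mem_enum => /andP[].
- by move=> y z; rewrite !mem_filter => /andP[/eqP-> _] /andP[/eqP-> _].
Qed.

(* tau_(i-1) ... tau_0 *)
Definition row_below i A := foldl (fun B j => rank_toggle le P rk j B) A (iota 0 i).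

Lemma row_belowS i A :
  row_below i.+1 A = rank_toggle le P rk i (row_below i A).
Proof. by rewrite /row_below -addn1 iotaD foldl_cat. Qed.

Lemma row_below_antichains i : {homo row_below i : A / A \in antichains le P}.
Proof.
move=> A PA; elim: i => // i IHi.
by rewrite row_belowS; apply: rank_toggle_antichains.
Qed.

Lemma row_below_inj i : {in antichains le P &, injective (row_below i)}.
Proof.
move=> A B PA PB; elim: i => // i IHi.
by rewrite !row_belowS => /rank_toggle_inj/IHi; apply; apply: row_below_antichains.
Qed.

(** During the upward sweep, an element of rank i outside the ideal of [A] is blocked exactly when a
    smaller element outside it was added before; an element of the ideal but not of [A] is blocked
    by a member of [A] above it, not yet toggled. Past the top rank this is the description of
    Row(A) as the minimal elements outside the ideal. *)
Lemma mem_row_below i A : A \in antichains le P -> forall x,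
  (x \in row_below i A) = (x \in P) &&
    if rk x < i then (x \notin D A) && [forall z in P, lt z x ==> (z \in D A)]
    else x \in A.
Proof.
move=> PA; have [sA aA] : A \subset P /\ antichain le A by apply/andP; rewrite inE in PA.
have sAD a : a \in A -> a \in D A.
  move=> aInA; rewrite inE (subsetP sA) //=.
  by apply/exists_inP; exists a; rewrite ?le_refl.
elim: i => [|i IHi] x.
  rewrite /row_below /=; have [xA|/negP xA] := boolP (x \in A).
    by rewrite (subsetP sA).
  by rewrite andbF.
rewrite row_belowS mem_rank_toggle ?row_below_antichains // ltnS leq_eqVlt.
have [xP|xNP] := boolP (x \in P); last by rewrite andbF IHi (negPf xNP).
rewrite andbT; have [ri|ri] := eqVneq (rk x) i; last by rewrite IHi xP.
rewrite IHi xP ri ltnn /=.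
apply/andP/andP => [[xA /forall_inP H]|[xD /forall_inP H]].
  have xD : x \notin D A.
    rewrite inE xP; apply/negP => /exists_inP[a aInA xa].
    have aP := subsetP sA _ aInA.
    have nxa : x != a by apply: contraNneq xA => ->.
    have ra : rk x < rk a by apply: rk_lt; rewrite // /lt_of xa.
    have /H : a \in row_below i A by rewrite IHi aP ltnNge -ri ltnW.
    by rewrite xa.
  split=> //; apply/forall_inP => z zP; apply/implyP => ltzx.
  apply/negPn/negP => zND.
  (* A minimal element of P \ D A below x would already have been added. *)
  pose E := [pred y | [&& y \in P, y \notin D A & lt y x]].
  have Ez : E z by rewrite /= zP zND.
  case: (arg_minnP rk Ez) => m /and3P[mP mD ltmx] mmin.
  have : m \in row_below i A.
    rewrite IHi mP -ri rk_lt // mD /=.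
    apply/forall_inP => y yP; apply/implyP => ltym; apply/negPn/negP => yD.
    have := mmin y; rewrite /= yP yD (lt_of_trans ltym ltmx) => /(_ isT).
    by rewrite leqNgt rk_lt.
  by move/H; case/andP: ltmx => -> _; rewrite andbF.
split; first by apply: contra xD => /sAD.
apply/forall_inP => y; rewrite IHi => /andP[yP].
case: ifP => [ryi /andP[yD _]|ryi yA].
  apply/andP; split; apply/negP => h.
    have nxy : x != y by apply: contraTneq ryi => <-; rewrite ri ltnn.
    have := rk_lt xP yP; rewrite /lt_of h nxy => /(_ isT).
    by rewrite ri ltnNge ltnW.
  have nxy : y != x by apply: contraTneq ryi => ->; rewrite ri ltnn.
  have := H y yP; rewrite /lt_of h nxy => /= yDA.
  by rewrite yDA in yD.
apply/andP; split; apply/negP => h.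
  by move/negP: xD; apply; rewrite inE xP; apply/exists_inP; exists y.
have nxy : y != x by apply: contraNneq xD => <-; apply: sAD.
have := rk_lt yP xP; rewrite /lt_of h nxy => /(_ isT).
by rewrite ri ryi.
Qed.

Lemma down_closure_row_below i A : A \in antichains le P ->
  D (row_below i A) = foldr t (D A) (iota 0 i).
Proof.
move=> PA; have [sA aA] : A \subset P /\ antichain le A by apply/andP; rewrite inE in PA.
have memB := mem_row_below i PA.
have [/subsetP sD dD] := down_closure_ideal A.
(* The word acts with rank i - 1 first, so the intermediate sets interpolate: ranks from i - d to i
   - 1 are already those of the new ideal, the others those of the old one. At d = i the two ideals
   agree from rank i on, since elements there lie only below members of rank at least i, which
   [row_below] leaves unchanged. *)
suff H d : d <= i -> foldr t (D A) (iota (i - d) d) =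
    [set x in P | if (i - d <= rk x) && (rk x < i)
                  then x \in D (row_below i A) else x \in D A].
  have := H i (leqnn i); rewrite subnn => ->.
  apply/setP => x; rewrite !(inE, in_setI) /=.
  case xP: (x \in P) => //=; case: ltnP => // ri.
  apply/exists_inP/exists_inP => -[a aB xa].
    move: aB; rewrite memB => /andP[aP]; case: ltnP => [ra _|]; last by exists a.
    have [eax|nxa] := eqVneq x a; first by move: ra; rewrite -eax ltnNge ri.
    have := rk_lt xP aP; rewrite /lt_of xa nxa => /(_ isT) h.
    by have := leq_trans (leq_trans h (ltnW ra)) ri; rewrite ltnn.
  have aP := subsetP sA _ aB.
  exists a => //; rewrite memB aP ltnNge.
  suff -> : i <= rk a by [].
  have [<-//|nxa] := eqVneq x a.
  have := rk_lt xP aP; rewrite /lt_of xa nxa => /(_ isT) /ltnW.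
  exact: leq_trans.
elim: d => [|d IHd] di.
  rewrite /=; apply/setP => x; rewrite [RHS]inE subn0.
  case: leqP => /= _; last first.
    by case xP: (x \in P) => //=; apply/negP => /sD; rewrite xP.
  by rewrite /down_closure inE; case: (x \in P).
have -> : iota (i - d.+1) d.+1 = (i - d.+1) :: iota (i - d) d.
  by rewrite /= subnSK.
rewrite /= (IHd (ltnW di)).
set j := i - d.+1; have ej : i - d = j.+1 by rewrite /j subnSK.
rewrite ej; set X := [set _ in _ | _].
have ji : j < i by rewrite -ej leq_subr.
have memX x : x \in P -> (x \in X) =
    (if (j < rk x) && (rk x < i) then x \in D (row_below i A) else x \in D A).
  by move=> xP; rewrite inE xP.
apply/setP => x; rewrite [LHS]inE [RHS]inE; case xP: (x \in P) => //=.
have [rj|rj] := eqVneq (rk x) j; last first.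
  by rewrite memX // [in RHS]leq_eqVlt eq_sym (negPf rj).
have memXx : (x \in X) = (x \in D A) by rewrite memX // rj ltnn.
rewrite memXx rj leqnn ji /=.
have [xD|xD] := boolP (x \in D A).
  rewrite inE xP /=; apply/exists_inP/exists_inP => -[y].
    move=> yX /andP[xy nxy]; have yP : y \in P by move: yX; rewrite inE => /andP[].
    have ry : j < rk y by rewrite -rj rk_lt // /lt_of xy.
    move: yX; rewrite memX // ry /=; case: ltnP => ryi.
      rewrite inE => /andP[_ /exists_inP[b bB yb]]; exists b => //.
      exact: le_trans yb.
    rewrite inE => /andP[_ /exists_inP[a aInA ya]].
    have aP := subsetP sA _ aInA.
    exists a; last exact: le_trans ya.
    rewrite memB aP ltnNge; suff -> : i <= rk a by [].
    have [<-//|nya] := eqVneq y a.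
    have := rk_lt yP aP; rewrite /lt_of ya nya => /(_ isT) /ltnW.
    exact: leq_trans.
  rewrite memB => /andP[yP yB] xy.
  have nxy : x != y.
    by apply: contraTneq yB => <-; rewrite rj ji xD.
  have ltxy : lt x y by rewrite /lt_of xy.
  exists y => //; rewrite memX // -rj rk_lt //=.
  case: ltnP yB => ry yB.
    rewrite inE yP; apply/exists_inP; exists y; last exact: le_refl.
    by rewrite memB yP ry.
  by rewrite inE yP; apply/exists_inP; exists y; rewrite ?le_refl.
transitivity [forall z in P, lt z x ==> (z \in D A)].
  apply: eq_forallb_in => z zP; case ltzx: (lt z x) => //=.
  by rewrite memX // ltnNge -rj ltnW // rk_lt.
(* Forwards, [x] itself belongs to [row_below i A]. Backwards, an upper bound [b] other than [x]
   would put [x] into [D A], whether [b] is minimal outside [D A] or a member of [A]. *)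
apply/idP/idP => [H|].
  rewrite inE xP; apply/exists_inP; exists x; last exact: le_refl.
  by rewrite memB xP rj ji xD.
rewrite inE xP => /exists_inP[b]; rewrite memB => /andP[bP bB] xb.
have [->|nxb] := eqVneq x b; case: ifP bB => [_ /andP[bD] //|_ bA].
- by move/negP: xD; case; rewrite inE xP; apply/exists_inP; exists b.
- move/forall_inP/(_ x xP); rewrite /lt_of xb nxb (negPf xD) //.
- by move/negP: xD; case; rewrite inE xP; apply/exists_inP; exists b.
Qed.

Local Notation N := (poset_rank P rk).

Lemma down_closure_rowmotion A : A \in antichains le P ->
  D (rowmotion le P rk A) = ideal_toggles P rk N 0 (D A).
Proof. by move=> PA; rewrite -[RHS]down_closure_row_below. Qed.

Lemma toggles_from_antichains i :
  {homo toggles_from le P rk i : A / A \in antichains le P}.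
Proof.
move=> A; rewrite /toggles_from; elim: (iota _ _) A => //= j s IHs A PA.
exact/IHs/rank_toggle_antichains.
Qed.

(** tau_N ... tau_i is Row after the inverse of tau_(i-1) ... tau_0. On W_0 X that inverse strips
    t_0 ... t_(i-1) and leaves W_i X, and Row puts a new W_0 in front. The pending W_0 thus survives
    every factor of Rvac, and Row^-1 removes it at the end. *)
Lemma down_closure_toggles_from i A X : i <= N.+1 ->
    A \in antichains le P -> order_ideal P X ->
    D A = ideal_toggles P rk N 0 X ->
  D (toggles_from le P rk i A) =
    ideal_toggles P rk N 0 (ideal_toggles P rk N i X).
Proof.
move=> iN PA idX eDA.
pose A' := finv (row_below i) A.
have PA' : A' \in antichains le P by apply: finv_in => //; apply: row_below_antichains.
have eA : A = row_below i A'.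
  by rewrite /A' (f_finv_in _ (@row_below_inj i)) //; apply: row_below_antichains.
have split_iota : iota 0 N.+1 = iota 0 i ++ iota i (N.+1 - i).
  by rewrite -{1}(subnKC iN) iotaD.
have eDA' : D A' = ideal_toggles P rk N i X.
  apply: (@foldr_ideal_toggle_inj (iota 0 i)); first exact: down_closure_ideal.
    exact: foldr_ideal_toggle_ideal.
  by rewrite -down_closure_row_below // -eA eDA /ideal_toggles subn0 split_iota foldr_cat.
rewrite -eDA' -down_closure_rowmotion //; congr (D _).
by rewrite eA /rowmotion /toggles_from /row_below subn0 split_iota foldl_cat.
Qed.

Lemma rowvacuation_antichains :
  {homo rowvacuation le P rk : A / A \in antichains le P}.
Proof.
move=> A; rewrite /rowvacuation; elim: (iota _ _) A => //= j s IHs A PA.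
exact/IHs/toggles_from_antichains.
Qed.

Lemma down_closure_rowvacuation A : A \in antichains le P ->
  D (rowvacuation le P rk A) =
    ideal_toggles P rk N 0 (ideal_vacuation P rk N 1 (D A)).
Proof.
move=> PA; rewrite /rowvacuation /ideal_vacuation /= subn1 /=.
have : all (fun i => i <= N.+1) (iota 1 N).
  by apply/allP => k; rewrite mem_iota add1n => /andP[_ /ltnW].
have := down_closure_rowmotion PA; rewrite -/(rowmotion le P rk A).
move: (rowmotion_antichains rk PA) (down_closure_ideal A).
move: (rowmotion _ _ _ _) (D A); elim: (iota 1 N) => //= k s IHs B X PB idX eB.
case/andP=> kN /IHs; apply; first exact: toggles_from_antichains.
  exact: ideal_toggles_ideal.
exact: down_closure_toggles_from.
Qed.

(* No t_0 occurs on the right, so Row^-1 Rvac preserves supports. *)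
Lemma down_closure_rowmotion_inv_rowvacuation A : A \in antichains le P ->
  D (rowmotion_inv le P rk (rowvacuation le P rk A)) =
    ideal_vacuation P rk N 1 (D A).
Proof.
move=> PA; have PB := rowvacuation_antichains PA.
apply: (@foldr_ideal_toggle_inj (iota 0 N.+1)).
- exact: down_closure_ideal.
- exact/ideal_vacuation_ideal/down_closure_ideal.
rewrite -[RHS]down_closure_rowvacuation // -[LHS]down_closure_rowmotion.
  by rewrite rowmotion_invK.
exact: rowmotion_inv_antichains.
Qed.

Lemma rowmotion_inv_rowvacuation_dihedral A :
    {in P &, forall x y, lt x y -> (rk x).+1 < rk y ->
      exists2 z, z \in P & lt x z && lt z y} ->
    A \in antichains le P ->
  let psi B := rowmotion_inv le P rk (rowvacuation le P rk B) in
  rowmotion le P rk (psi (rowmotion le P rk A)) = psi A.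
Proof.
move=> graded PA psi.
have Ppsi B : B \in antichains le P -> psi B \in antichains le P.
  by move/rowvacuation_antichains; apply: rowmotion_inv_antichains.
have PRA := rowmotion_antichains rk PA.
apply: down_closure_inj; [exact/rowmotion_antichains/Ppsi|exact: Ppsi|].
rewrite down_closure_rowmotion ?Ppsi // /psi.
rewrite !down_closure_rowmotion_inv_rowvacuation // down_closure_rowmotion //.
have idD := down_closure_ideal A.
have := @ideal_vacuation_dihedral graded N 0 _ idD.
have -> X : ideal_vacuation P rk N 0 X =
    ideal_vacuation P rk N 1 (ideal_toggles P rk N 0 X).
  by rewrite /ideal_vacuation subn1.
rewrite subn0 => ->.
rewrite /ideal_toggles subn0 foldr_foldl_ideal_toggle //.
exact: ideal_vacuation_ideal.
Qed.

End Poset.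

(** * Restriction to a down-closed subset *)

Section Restriction.
Variables (P Q : {set T}) (rk : T -> nat).
Hypothesis sQP : Q \subset P.
Hypothesis downQ : {in P & Q, forall x y, le x y -> x \in Q}.
Hypothesis outQ : {in P :\: Q, forall x, 0 < rk x ->
  exists2 z, z \in P :\: Q & lt_of z x}.

Lemma ideal_toggle_sub i X : ideal_toggle Q rk i X \subset Q.
Proof. by apply/subsetP => x; rewrite inE => /andP[]. Qed.

(** At positive rank an element outside [Q] has a smaller one outside [Q], hence missing from [X],
    so it cannot be added. Rank 0 is excluded because minimal elements outside [Q] could be. *)
Lemma ideal_toggle_restrict i X : 0 < i -> X \subset Q ->
  ideal_toggle P rk i X = ideal_toggle Q rk i X.
Proof.
move=> i0 /subsetP sXQ; apply/setP => x; rewrite [LHS]inE [RHS]inE.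
have [xQ|xNQ] := boolP (x \in Q).
  rewrite (subsetP sQP) //=; case: eqP => // _; case: ifP => // _.
  apply/forall_inP/forall_inP => H z zP; apply/implyP => ltzx.
    by apply: (implyP (H z _)) => //; apply: (subsetP sQP).
  by apply: (implyP (H z _)) => //; apply: downQ xQ _ => //; case/andP: ltzx.
case xP: (x \in P) => //=.
have -> : (x \in X) = false by apply: contraNF xNQ => /sXQ.
case: eqP => // ri; apply/negP => /forall_inP H.
have [||z] := outQ (x := x); rewrite ?inE ?xNQ ?ri // => /andP[zNQ zP] ltzx.
by have /implyP/(_ ltzx)/sXQ := H z zP; rewrite (negPf zNQ).
Qed.

Lemma ideal_toggles_sub N i X : X \subset Q -> ideal_toggles Q rk N i X \subset Q.
Proof.
by rewrite /ideal_toggles; case: (iota _ _) => //= *; apply: ideal_toggle_sub.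
Qed.

Lemma ideal_toggles_restrict N i X : 0 < i -> X \subset Q ->
  ideal_toggles P rk N i X = ideal_toggles Q rk N i X.
Proof.
move=> i0 sX; rewrite /ideal_toggles.
have : all (fun k => 0 < k) (iota i (N.+1 - i)).
  by apply/allP => k; rewrite mem_iota => /andP[ik _]; apply: leq_trans ik.
elim: (iota _ _) => //= k s IHs /andP[k0 /IHs->]; apply: ideal_toggle_restrict => //.
by case: (s) => //= *; apply: ideal_toggle_sub.
Qed.

Lemma ideal_vacuation_restrict N X : X \subset Q ->
  ideal_vacuation P rk N 1 X = ideal_vacuation Q rk N 1 X.
Proof.
rewrite /ideal_vacuation.
have : all (fun k => 0 < k) (iota 1 (N.+1 - 1)).
  by apply/allP => k; rewrite mem_iota => /andP[].
elim: (iota _ _) X => //= k s IHs X /andP[k0 s0] sX.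
by rewrite IHs ?ideal_toggles_restrict // ideal_toggles_sub.
Qed.

(** [Q] has no elements above its own top rank, so the toggles there are trivial. This is where the
    top rank of the large poset is replaced by that of the small one. *)
Lemma ideal_vacuation_rank N X : poset_rank Q rk <= N -> X \subset Q ->
  ideal_vacuation Q rk N 1 X = ideal_vacuation Q rk (poset_rank Q rk) 1 X.
Proof.
move=> /subnKC <-; move: (N - _) => d {N}; elim: d X => [|d IHd] X sX; first by rewrite addn0.
rewrite -IHd // addnS; set M := _ + d.
have triv Y : Y \subset Q -> ideal_toggle Q rk M.+1 Y = Y.
  move=> sY; apply/setP => x; rewrite inE.
  case xQ: (x \in Q) => /=; last by apply/esym; apply: contraFF xQ => /(subsetP sY).
  rewrite ltn_eqF // ltnS (leq_trans _ (leq_addr _ _)) //.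
  exact: (@leq_bigmax_cond _ [in Q] rk).
have tog k Y : k <= M.+1 -> Y \subset Q ->
    ideal_toggles Q rk M.+1 k Y = ideal_toggles Q rk M k Y.
  move=> kM sY; rewrite /ideal_toggles (subSn kM) -addn1 iotaD foldr_cat.
  by rewrite subnKC //= triv.
have -> : ideal_vacuation Q rk M.+1 1 X = ideal_toggles Q rk M.+1 M.+1
    (foldl (fun Z k => ideal_toggles Q rk M.+1 k Z) X (iota 1 M)).
  by rewrite /ideal_vacuation !subSS !subn0 -{2}addn1 iotaD foldl_cat /= add1n.
rewrite [in RHS]/ideal_vacuation subSS subn0.
have sF s Y : Y \subset Q -> foldl (fun Z k => ideal_toggles Q rk M k Z) Y s \subset Q.
  by elim: s Y => //= k s IHs Y sY; apply/IHs/ideal_toggles_sub.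
have -> : foldl (fun Z k => ideal_toggles Q rk M.+1 k Z) X (iota 1 M) =
    foldl (fun Z k => ideal_toggles Q rk M k Z) X (iota 1 M).
  have : all (fun k => k <= M.+1) (iota 1 M).
    by apply/allP => k; rewrite mem_iota add1n => /andP[_ /ltnW].
  elim: (iota 1 M) X sX => //= k s IHs X sX /andP[kM /IHs{}IHs].
  by rewrite tog // IHs // ideal_toggles_sub.
by rewrite {1}/ideal_toggles subSnn /= triv // sF.
Qed.

Hypothesis le_refl : reflexive le.
Hypothesis le_anti : antisymmetric le.
Hypothesis le_trans : transitive le.
Hypothesis rk_lt : {in P &, forall x y, lt_of x y -> rk x < rk y}.

Lemma rowmotion_inv_rowvacuation_restrict A : A \in antichains le Q ->
  rowmotion_inv le P rk (rowvacuation le P rk A) =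
  rowmotion_inv le Q rk (rowvacuation le Q rk A).
Proof.
move=> QA; have rk_ltQ : {in Q &, forall x y, lt_of x y -> rk x < rk y}.
  by move=> x y /(subsetP sQP) xP /(subsetP sQP) yP; apply: rk_lt.
have QP B : B \in antichains le Q -> B \in antichains le P.
  by rewrite !inE => /andP[sB ->]; rewrite (subset_trans sB).
have DE B : B \in antichains le Q -> down_closure P B = down_closure Q B.
  rewrite inE => /andP[/subsetP sB _]; apply/setP => x; rewrite !inE.
  apply/andP/andP => -[xP /exists_inP[b bB xb]]; split; try by apply/exists_inP; exists b.
    by apply: downQ xb => //; apply: sB.
  exact: (subsetP sQP).
have Qpsi := rowmotion_inv_antichains rk (rowvacuation_antichains rk QA).
apply: (down_closure_inj (P := P)) => //.
- exact/rowmotion_inv_antichains/rowvacuation_antichains/QP.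
- exact: QP.
have -> := down_closure_rowmotion_inv_rowvacuation le_refl le_anti le_trans rk_lt (QP _ QA).
rewrite (DE _ Qpsi) (DE _ QA).
have -> := down_closure_rowmotion_inv_rowvacuation le_refl le_anti le_trans rk_ltQ QA.
have sD : down_closure Q A \subset Q by apply/subsetP => x; rewrite inE => /andP[].
rewrite ideal_vacuation_restrict // ideal_vacuation_rank //.
by apply/bigmax_leqP => x xQ; apply: (@leq_bigmax_cond _ [in P] rk); apply: (subsetP sQP).
Qed.

End Restriction.
End IdealToggles.

Local Open Scope ring_scope.

(** * Orthogonal reflections *)

Section Dot.
Variables (K : archiRealFieldType) (n : nat).
Implicit Types (u v b : 'cV[K]_n) (g h : 'M[K]_n).

Lemma dotE u v : dot u v = \sum_i u i 0 * v i 0.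
Proof. by rewrite /dot mxE; apply: eq_bigr => i _; rewrite mxE. Qed.

Lemma dotC u v : dot u v = dot v u.
Proof. by rewrite !dotE; apply: eq_bigr => i _; rewrite mulrC. Qed.

Lemma dotDr u v w : dot u (v + w) = dot u v + dot u w.
Proof. by rewrite /dot mulmxDr mxE. Qed.

Lemma dotZr u k v : dot u (k *: v) = k * dot u v.
Proof. by rewrite /dot -scalemxAr mxE. Qed.

Lemma dot0r u : dot u 0 = 0.
Proof. by rewrite /dot mulmx0 mxE. Qed.

Lemma dotNr u v : dot u (- v) = - dot u v.
Proof. by rewrite /dot mulmxN mxE. Qed.

Lemma dotBr u v w : dot u (v - w) = dot u v - dot u w.
Proof. by rewrite dotDr dotNr. Qed.

Lemma dot_sumr (I : finType) (P : pred I) u (F : I -> 'cV[K]_n) :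
  dot u (\sum_(i | P i) F i) = \sum_(i | P i) dot u (F i).
Proof. by apply: (big_morph (dot u)) => [v w|]; rewrite ?dotDr ?dot0r. Qed.

Lemma dotvv_ge0 v : 0 <= dot v v.
Proof. by rewrite dotE sumr_ge0 // => i _; rewrite -expr2 sqr_ge0. Qed.

Lemma dotvv_eq0 v : (dot v v == 0) = (v == 0).
Proof.
apply/eqP/eqP => [|->]; last exact: dot0r.
rewrite dotE => /eqP; rewrite psumr_eq0; last by move=> i _; rewrite -expr2 sqr_ge0.
move=> /allP H; apply/colP => i; rewrite [RHS]mxE.
by have /implyP/(_ isT) := H i (mem_index_enum i); rewrite mulf_eq0 orbb => /eqP.
Qed.

Lemma dotvv_gt0 v : (0 < dot v v) = (v != 0).
Proof. by rewrite lt_def dotvv_ge0 andbT dotvv_eq0. Qed.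

Lemma mul_outer u v w : (u *m v^T) *m w = dot v w *: u.
Proof. by rewrite -mulmxA [v^T *m w]mx11_scalar mul_mx_scalar. Qed.

Lemma reflectionE b v :
  reflection b *m v = v - (2 * dot b v / dot b b) *: b.
Proof.
rewrite /reflection mulmxBl mul1mx -scalemxAl mul_outer scalerA.
by rewrite mulrAC.
Qed.

Lemma reflection_id b : b != 0 -> reflection b *m b = - b.
Proof.
rewrite -dotvv_eq0 => b0; rewrite reflectionE mulfK //.
by rewrite scaler_nat mulr2n opprD addNKr.
Qed.

Lemma reflectionN b : reflection (- b) = reflection b.
Proof. by rewrite /reflection dotNr dotC dotNr opprK linearN /= mulmxN mulNmx opprK. Qed.

Lemma tr_reflection b : (reflection b)^T = reflection b.
Proof. by rewrite /reflection linearB /= linearZ /= trmx1 trmx_mul trmxK. Qed.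

Lemma reflectionK b : reflection b *m reflection b = 1%:M.
Proof.
have [->|b0] := eqVneq b 0; first by rewrite /reflection mul0mx scaler0 subr0 mul1mx.
rewrite {2}/reflection mulmxBr mulmx1 -scalemxAr mulmxA reflection_id //.
by rewrite mulNmx scalerN opprK /reflection subrK.
Qed.

Definition orthogonal_mx g := g^T *m g == 1%:M.

Lemma orthogonal_mx1 : orthogonal_mx 1%:M.
Proof. by rewrite /orthogonal_mx trmx1 mul1mx. Qed.

Lemma orthogonal_mxM g h :
  orthogonal_mx g -> orthogonal_mx h -> orthogonal_mx (g *m h).
Proof.
rewrite /orthogonal_mx => /eqP Hg /eqP Hh.
by rewrite trmx_mul mulmxA -(mulmxA _ _ g) Hg mulmx1 Hh.
Qed.

Lemma orthogonal_reflection b : orthogonal_mx (reflection b).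
Proof. by rewrite /orthogonal_mx tr_reflection reflectionK. Qed.

Lemma orthogonal_unitmx g : orthogonal_mx g -> g \in unitmx.
Proof. by move=> /eqP/mulmx1_unit[]. Qed.

Lemma orthogonal_invmx g : orthogonal_mx g -> invmx g = g^T.
Proof.
move=> Hg; have ug := orthogonal_unitmx Hg.
by rewrite -[LHS]mul1mx -(eqP Hg) mulmxK.
Qed.

Lemma dot_orthogonal g u v : orthogonal_mx g -> dot (g *m u) (g *m v) = dot u v.
Proof.
by move=> /eqP Hg; rewrite /dot trmx_mul mulmxA -(mulmxA _ _ g) Hg mulmx1.
Qed.

Lemma reflection_conj g b : orthogonal_mx g ->
  reflection (g *m b) = g *m reflection b *m invmx g.
Proof.
move=> Hg; rewrite orthogonal_invmx // {2}/reflection mulmxBr mulmxBl mulmx1.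
rewrite (mulmx1C (eqP Hg)) /reflection dot_orthogonal // -scalemxAr -scalemxAl.
by rewrite trmx_mul !mulmxA.
Qed.

(** Double orthogonal complement: the columns of the cokernel of the matrix with rows [s] are
    orthogonal to [s], so b^T annihilates this cokernel and lies in the row space. *)
Lemma mem_span_orthogonal (s : seq 'cV[K]_n) b :
    (forall v, {in s, forall x, dot x v = 0} -> dot b v = 0) ->
  b \in <<s>>%VS.
Proof.
move=> H; pose G : 'M[K]_(size s, n) := \matrix_(i < size s) (s`_i)^T.
have : (b^T <= G)%MS.
  rewrite submxE; apply/eqP/matrixP => k j; rewrite ord1 mxE.
  have -> : \sum_j0 b^T 0 j0 * cokermx G j0 j = dot b (col j (cokermx G)).
    by rewrite dotE; apply: eq_bigr => i _; rewrite !mxE.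
  rewrite H ?mxE // => x /(nthP 0)[i si <-].
  have /matrixP/(_ (Ordinal si) j) := mulmx_coker G; rewrite !mxE => e.
  rewrite dotE -[RHS]e; apply: eq_bigr => l _.
  by rewrite [col _ _ _ _]mxE [G _ _]mxE [_^T _ _]mxE.
case/submxP => C e.
have -> : b = \sum_(i < size s) C 0 i *: s`_i.
  apply/colP => j; have /rowP/(_ j) := e; rewrite mxE => ->.
  rewrite summxE mxE; apply: eq_bigr => i _.
  by rewrite [G _ _]mxE [_^T _ _]mxE [RHS]mxE.
by apply: memv_suml => i _; rewrite memvZ // memv_span // mem_nth.
Qed.

End Dot.

(** * Root posets *)

Section Roots.
Variables (K : archiRealFieldType) (n r : nat).
Variables (Phi : seq 'cV[K]_n) (alpha : r.-tuple 'cV[K]_n).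
Hypothesis Phi_rs : root_system Phi.
Hypothesis alpha_ss : simple_system Phi alpha.

Local Notation V := 'cV[K]_n.
Local Notation root := (seq_sub Phi).
Local Notation sr := (tnth alpha).
Local Notation co := (coord alpha).
Implicit Types (a b : V) (i j : 'I_r) (J X : {set 'I_r}).

Lemma root_dot_gt0 b : b \in Phi -> 0 < dot b b.
Proof. by rewrite dotvv_gt0; apply: contraTneq => ->; apply: root_neq0. Qed.

Lemma root_opp b : b \in Phi -> - b \in Phi.
Proof.
move=> bP; rewrite -reflection_id; first exact: root_reflection.
by rewrite -dotvv_gt0 root_dot_gt0.
Qed.

Lemma simple_in i : sr i \in Phi.
Proof. by apply: (simple_root alpha_ss); apply: mem_tnth. Qed.

Lemma coord_simple i j : co j (sr i) = (i == j)%:R.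
Proof. by rewrite (tnth_nth 0) coord_free //; case: alpha_ss. Qed.

Lemma coord_sum_simple (k : 'I_r -> K) j : co j (\sum_i k i *: sr i) = k j.
Proof.
rewrite linear_sum (bigD1 j) //= big1 => [|i ij].
  by rewrite linearZ /= coord_simple eqxx mulr1 addr0.
by rewrite linearZ /= coord_simple (negPf ij) mulr0.
Qed.

Lemma root_expand b : b \in Phi -> b = \sum_i co i b *: sr i.
Proof.
case/(simple_sign alpha_ss) => m [] ->.
  by apply: eq_bigr => i _; rewrite coord_sum_simple.
rewrite -[LHS]sumrN; apply: eq_bigr => i _; rewrite linearN /= coord_sum_simple.
by rewrite scaleNr.
Qed.

Lemma root_sign b : b \in Phi -> nonneg_simple_sum alpha b \/ nonneg_simple_sum alpha (- b).
Proof.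
case/(simple_sign alpha_ss) => m [] ->; [left|right]; apply/forallP => i;
  by rewrite ?opprK coord_sum_simple natr_nat.
Qed.

(** Roots need not span the ambient space, and [coord] determines a vector only inside the span of
    [alpha]; the expansion hypotheses express membership in that span. *)
Lemma eq_coord (a b : V) : a = \sum_i co i a *: sr i -> b = \sum_i co i b *: sr i ->
  (forall i, co i a = co i b) -> a = b.
Proof. by move=> ea eb e; rewrite ea eb; apply: eq_bigr => i _; rewrite e. Qed.

Lemma expandB a b : a = \sum_i co i a *: sr i -> b = \sum_i co i b *: sr i ->
  a - b = \sum_i co i (a - b) *: sr i.
Proof.
move=> ea eb; rewrite {1}ea {1}eb -sumrB.
by apply: eq_bigr => i _; rewrite linearB /= scalerBl.
Qed.

Lemma mem_simple_spanP J v :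
  reflect (v = \sum_i co i v *: sr i /\ forall i, i \notin J -> co i v = 0)
          (v \in <<[seq sr i | i in J]>>%VS).
Proof.
apply: (iffP idP) => [|[ev H]]; last first.
  rewrite ev (bigID [in J]) /= [X in _ + X]big1 ?addr0; last first.
    by move=> i iJ; rewrite H // scale0r.
  apply: memv_suml => i iJ; rewrite memvZ // memv_span //.
  exact: image_f.
set s := [seq _ | _ in _]; rewrite -[s]/(tval (in_tuple s)) => /coord_span ev.
pose E u := u = \sum_i co i u *: sr i /\ forall i, i \notin J -> co i u = 0.
suff : E v by [].
rewrite ev; apply: (big_ind E) => [|u u' [eu zu] [eu' zu']|k _].
- split=> [|i _]; last by rewrite linear0.
  by rewrite big1 // => i _; rewrite linear0 scale0r.
- split=> [|i iJ]; last by rewrite linearD /= zu ?zu' ?addr0.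
  rewrite {1}eu {1}eu' -big_split /=.
  by apply: eq_bigr => i _; rewrite linearD scalerDl.
have /imageP[j jJ ->] : s`_k \in s by apply: mem_nth.
set x := coord _ _ _; split=> [|i iJ].
  have ej := root_expand (simple_in j); rewrite [in LHS]ej scaler_sumr.
  by apply: eq_bigr => i _; rewrite scalerA [co i (_ *: _)]linearZ.
rewrite linearZ /= coord_simple; case: eqP iJ jJ => [->|_ _ _]; last by rewrite mulr0.
by move/negPf->.
Qed.

Lemma mem_parabolic J (b : root) :
  reflect (forall i, i \notin J -> co i (val b) = 0) (b \in parabolic_roots Phi alpha J).
Proof.
rewrite inE; apply: (iffP (mem_simple_spanP _ _)) => [[]//|H].
by split=> //; apply/root_expand/valP.
Qed.

(** Expanding one argument of (v, v) > 0 in simple roots yields a positive term, whose two factors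
    are then both positive. *)
Lemma nonneg_coord_gt0 v : v = \sum_i co i v *: sr i -> nonneg_simple_sum alpha v ->
  v != 0 -> exists2 i, 0 < co i v & 0 < dot v (sr i).
Proof.
move=> ev /forallP nn; rewrite -dotvv_gt0 {2}ev dot_sumr => Hpos.
have [/existsP[i /andP[ci di]]|/existsPn H] :=
    boolP [exists i, (0 < co i v) && (0 < dot v (sr i))]; first by exists i.
suff : \sum_i dot v (co i v *: sr i) <= 0 by rewrite leNgt Hpos.
apply: sumr_le0 => i _; rewrite dotZr.
have := H i; rewrite negb_and -!leNgt => /orP[ci|di].
  suff -> : co i v = 0 by rewrite mul0r.
  by apply/le_anti; rewrite ci natr_ge0.
by apply: mulr_ge0_le0 => //; apply: natr_ge0.
Qed.

Lemma int_ge2 (x : K) : x \is a Num.int -> 0 < x -> x != 1 -> 2 <= x.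
Proof.
move=> /intrP[m ->]; rewrite ltr0z -[1]/(1%:~R) eqr_int -[2]/(2%:~R) ler_int.
by case: m => [[|[|m]]|m].
Qed.

(* If neither Cartan integer of [a] and [b] is 1, both are at least 2, which
   forces |a - b|^2 <= 0. *)
Lemma root_sub a b : a \in Phi -> b \in Phi -> 0 < dot a b -> a != b ->
  a - b \in Phi.
Proof.
move=> aP bP ab nab.
have aa := root_dot_gt0 aP; have bb := root_dot_gt0 bP.
have [p1|p1] := eqVneq (2 * dot a b / dot a a) 1.
  rewrite -opprB; apply: root_opp.
  by have := root_reflection Phi_rs aP bP; rewrite reflectionE p1 scale1r.
have [q1|q1] := eqVneq (2 * dot b a / dot b b) 1.
  by have := root_reflection Phi_rs bP aP; rewrite reflectionE q1 scale1r.
have := int_ge2 (root_crystallographic Phi_rs aP bP) _ p1.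
have := int_ge2 (root_crystallographic Phi_rs bP aP) _ q1.
rewrite !divr_gt0 ?mulr_gt0 // 1?dotC // => /(_ isT) q2 /(_ isT) p2.
move: p2 q2; rewrite !ler_pdivlMr // !ler_pM2l // => p2 q2.
have : dot (a - b) (a - b) <= 0.
  rewrite dotBr ![dot (a - b) _]dotC !dotBr opprB.
  by rewrite -[X in _ <= X]addr0 lerD // subr_le0 // dotC.
by rewrite leNgt dotvv_gt0 subr_eq0 nab.
Qed.

Lemma le_root_refl : reflexive (@le_root K n r Phi alpha).
Proof. by move=> x; apply/forallP => i; rewrite subrr linear0 rpred0. Qed.

Lemma le_root_trans : transitive (@le_root K n r Phi alpha).
Proof.
move=> y x z /forallP xy /forallP yz; apply/forallP => i.
by rewrite -(subrK (val y) (val z)) -addrA linearD rpredD ?xy ?yz.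
Qed.

Lemma le_root_anti : antisymmetric (@le_root K n r Phi alpha).
Proof.
move=> x y /andP[/forallP xy /forallP yx]; apply/val_inj.
apply: eq_coord; try exact/root_expand/valP.
move=> i; have := natr_ge0 (xy i); have := natr_ge0 (yx i).
by rewrite !linearB /= !subr_ge0 => h1 h2; apply/le_anti; rewrite h1 h2.
Qed.

Lemma heightE v : nonneg_simple_sum alpha v -> (height alpha v)%:R = \sum_i co i v.
Proof.
by move/forallP => nn; rewrite natr_sum; apply: eq_bigr => i _; rewrite truncnK.
Qed.

Lemma heightD u v : nonneg_simple_sum alpha u -> nonneg_simple_sum alpha v ->
  height alpha (u + v) = (height alpha u + height alpha v)%N.
Proof.
move=> nu nv; apply/eqP; rewrite -(eqr_nat K) natrD !heightE //.
  by rewrite -big_split /=; apply/eqP/eq_bigr => i _; rewrite linearD.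
by apply/forallP => i; rewrite linearD rpredD // (forallP nu, forallP nv).
Qed.

Lemma height_gt0 v : v = \sum_i co i v *: sr i -> nonneg_simple_sum alpha v ->
  v != 0 -> (0 < height alpha v)%N.
Proof.
move=> ev nv v0; have [i ci _] := nonneg_coord_gt0 ev nv v0.
rewrite -(ltr_nat K) heightE // (bigD1 i) //= ltr_wpDr // sumr_ge0 // => j _.
exact/natr_ge0/(forallP nv).
Qed.

Lemma nonneg_simple i : nonneg_simple_sum alpha (sr i).
Proof. by apply/forallP => j; rewrite coord_simple natr_nat. Qed.

Lemma height_simple i : height alpha (sr i) = 1%N.
Proof.
apply/eqP; rewrite -(eqr_nat K) heightE ?nonneg_simple // (bigD1 i) //= big1.
  by rewrite coord_simple eqxx addr0.
by move=> j; rewrite coord_simple eq_sym => /negPf->.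
Qed.

Lemma root_nonzero b : b \in Phi -> b != 0.
Proof. by rewrite -dotvv_gt0; apply: root_dot_gt0. Qed.

Lemma root_poset_nonneg J (x : root) :
  x \in root_poset Phi alpha J -> nonneg_simple_sum alpha (val x).
Proof. by rewrite inE => /andP[]. Qed.

Lemma height_root_gt0 J (x : root) : x \in root_poset Phi alpha J ->
  (0 < height alpha (val x))%N.
Proof.
move=> /root_poset_nonneg nx; apply: height_gt0 => //; first exact/root_expand/valP.
exact/root_nonzero/valP.
Qed.

Lemma height_lt J (x y : root) : x \in root_poset Phi alpha J ->
  lt_of (@le_root K n r Phi alpha) x y ->
  (height alpha (val x) < height alpha (val y))%N.
Proof.
move=> xJ /andP[xy nxy].
rewrite -[in val y](subrK (val x) (val y)) addrC heightD //; last first.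
  exact: root_poset_nonneg xJ.
rewrite -{1}[height _ (val x)]addn0 ltn_add2l height_gt0 //.
  by apply: expandB; apply/root_expand/valP.
by rewrite subr_eq0 eq_sym; apply: contra nxy => /eqP/val_inj->.
Qed.

Lemma root_rank_lt J : {in root_poset Phi alpha J &, forall x y : root,
  lt_of (@le_root K n r Phi alpha) x y -> (root_rank alpha x < root_rank alpha y)%N}.
Proof.
move=> x y xJ yJ /(height_lt xJ); rewrite /root_rank.
by case: (height _ (val x)) (height_root_gt0 xJ) => // k _; case: (height _ (val y)).
Qed.

(** Some alpha_i in the support of y - x has (y - x, alpha_i) > 0, so (y, alpha_i) > 0 or (x,
    alpha_i) < 0, and [root_sub] applies to y or to x. *)
Lemma root_poset_cover J : {in root_poset Phi alpha J &, forall x y : root,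
    lt_of (@le_root K n r Phi alpha) x y ->
  exists i, 0 < co i (val y - val x) /\
    (val y - sr i \in Phi \/ val x + sr i \in Phi)}.
Proof.
move=> x y xJ yJ /andP[xy nxy].
have [||i ci] := @nonneg_coord_gt0 (val y - val x) _ xy.
- by apply: expandB; apply/root_expand/valP.
- by rewrite subr_eq0 eq_sym; apply: contra nxy => /eqP/val_inj->.
have nx := forallP (root_poset_nonneg xJ).
rewrite dotC dotBr subr_gt0 => di; exists i; split=> //.
have [yi|yi] := ltP 0 (dot (val y) (sr i)).
  left; apply: root_sub yi _; [exact: valP|exact: simple_in|].
  (* If y were alpha_i, then x <= y would kill the coordinates of x off i, and the positive i-th
     coordinate of y - x would kill the remaining one, so x = 0. *)
  apply/eqP => ey; move: ci xy; rewrite /le_root /root_le ey => ci /forallP xy.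
  move/eqP: (root_nonzero (valP x)); apply; rewrite (root_expand (valP x)).
  apply: big1 => j _; suff -> : co j (val x) = 0 by rewrite scale0r.
  have [e|ij] := eqVneq i j; last first.
    apply/le_anti; rewrite natr_ge0 // andbT.
    by have := natr_ge0 (xy j); rewrite linearB /= coord_simple (negPf ij) sub0r oppr_ge0.
  move: ci; rewrite -e linearB /= coord_simple eqxx.
  have /natrP[m ->] := nx i; rewrite subr_gt0 -[1]/(1%:R) ltr_nat.
  by case: m.
right; rewrite -[sr i]opprK; apply: root_sub.
- exact: valP.
- exact/root_opp/simple_in.
- by rewrite dotNr oppr_gt0 dotC (lt_le_trans di) // dotC.
apply/eqP => ex; have := nx i; rewrite ex linearN /= coord_simple eqxx.
by move/natr_ge0; rewrite oppr_ge0 ler10.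
Qed.

Lemma root_poset_graded J : {in root_poset Phi alpha J &, forall x y : root,
    lt_of (@le_root K n r Phi alpha) x y ->
    ((root_rank alpha x).+1 < root_rank alpha y)%N ->
  exists2 z, z \in root_poset Phi alpha J &
    lt_of (@le_root K n r Phi alpha) x z && lt_of (@le_root K n r Phi alpha) z y}.
Proof.
move=> x y xJ yJ ltxy hxy.
have {}hxy : ((height alpha (val x)).+1 < height alpha (val y))%N.
  move: hxy; rewrite /root_rank.
  by case: (height _ (val x)) (height_root_gt0 xJ) => // k _; case: (height _ (val y)).
have [i [ci Hroot]] := root_poset_cover xJ yJ ltxy.
have [xy _] := andP ltxy; have nn := forallP xy.
have nx := root_poset_nonneg xJ; have ny := root_poset_nonneg yJ.
have nd : nonneg_simple_sum alpha (val y - val x - sr i).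
  apply/forallP => j; rewrite linearB /= coord_simple.
  have [<-|ij] := eqVneq i j; last by rewrite subr0.
  move: ci; have /natrP[m ->] := nn i; case: m => [|m _]; first by rewrite ltxx.
  by rewrite -natrB // natr_nat.
(* A vector between 0 and y has zero coordinates wherever y has, so the intermediate root stays in
   Phi_J. *)
have zJ z : nonneg_simple_sum alpha z -> nonneg_simple_sum alpha (val y - z) ->
    forall zP : z \in Phi, SeqSub zP \in root_poset Phi alpha J.
  move=> nz nyz zP; rewrite inE nz andbT; apply/mem_parabolic => j jJ /=.
  apply/le_anti; rewrite natr_ge0 ?(forallP nz) // andbT.
  have := natr_ge0 (forallP nyz j); rewrite linearB /= subr_ge0.
  suff -> : co j (val y) = 0 by [].
  by move: yJ; rewrite inE => /andP[/mem_parabolic-> //].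
have neq (u v : root) : height alpha (val u) != height alpha (val v) -> u != v.
  by apply: contraNneq => ->.
have hi := height_simple i; have ni := nonneg_simple i.
have nyi : nonneg_simple_sum alpha (val y - sr i).
  rewrite (_ : _ - _ = val x + (val y - val x - sr i)).
    by apply/forallP => j; rewrite linearD rpredD // (forallP nx, forallP nd).
  by rewrite addrA (addrC (val x)) subrK.
case: Hroot => zP; exists (SeqSub zP).
- apply: zJ => //; rewrite (_ : _ - _ = sr i) //.
  by rewrite opprB addrC subrK.
- have hz : height alpha (val y) = (height alpha (val y - sr i)).+1.
    by rewrite -{1}(subrK (sr i) (val y)) (heightD nyi ni) hi addn1.
  apply/andP; split; apply/andP; split.
  + by rewrite /le_root /root_le /= addrAC.
  + by rewrite neq //= ltn_eqF // -ltnS -hz.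
  + by rewrite /le_root /root_le /= opprB addrC subrK.
  + by rewrite neq //= hz ltn_eqF.
- apply: zJ; last by rewrite opprD addrA.
  by apply/forallP => j; rewrite linearD rpredD // (forallP nx, forallP ni).
have hz : height alpha (val x + sr i) = (height alpha (val x)).+1.
  by rewrite heightD // hi addn1.
apply/andP; split; apply/andP; split.
- by rewrite /le_root /root_le /= addrC addKr.
- by rewrite neq //= hz ltn_eqF.
- by rewrite /le_root /root_le /= opprD addrA.
- by rewrite neq //= hz ltn_eqF.
Qed.

Lemma root_poset_sub J' J : J' \subset J ->
  root_poset Phi alpha J' \subset root_poset Phi alpha J.
Proof.
move=> /subsetP sJ; apply/subsetP => x; rewrite inE => /andP[/mem_parabolic xJ nx].
rewrite inE nx andbT; apply/mem_parabolic => i iJ; apply: xJ.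
by apply: contra iJ => /sJ.
Qed.

Lemma nonnesting_sub J' J A : J' \subset J ->
  A \in nonnesting Phi alpha J' -> A \in nonnesting Phi alpha J.
Proof. by move=> sJ; rewrite !inE => /andP[sA ->]; rewrite (subset_trans sA) ?root_poset_sub. Qed.

Lemma Row_inv_Rvac_dihedral J A : A \in nonnesting Phi alpha J ->
  Row alpha J (Row_inv alpha J (Rvac alpha J (Row alpha J A))) =
  Row_inv alpha J (Rvac alpha J A).
Proof.
move=> AJ; apply: rowmotion_inv_rowvacuation_dihedral => //.
- exact: le_root_refl.
- exact: le_root_anti.
- exact: le_root_trans.
- exact: root_rank_lt.
- exact: root_poset_graded.
Qed.

Lemma Row_inv_Rvac_restrict J' J A : J' \subset J ->
  A \in nonnesting Phi alpha J' ->
  Row_inv alpha J (Rvac alpha J A) = Row_inv alpha J' (Rvac alpha J' A).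
Proof.
move=> sJ AJ; apply: rowmotion_inv_rowvacuation_restrict => //.
- exact: root_poset_sub.
- move=> x y xJ yJ' /forallP xy; have nx := root_poset_nonneg xJ.
  rewrite inE nx andbT; apply/mem_parabolic => i iJ'.
  apply/le_anti; rewrite natr_ge0 ?(forallP nx) // andbT.
  have := natr_ge0 (xy i); rewrite linearB /= subr_ge0.
  suff -> : co i (val y) = 0 by [].
  by move: yJ'; rewrite inE => /andP[/mem_parabolic-> //].
(* A positive root outside Phi_(J') lies above some alpha_i with i outside J', and differs from it
   because its rank is positive. *)
- move=> x; rewrite in_setD => /andP[xNJ' xJ] rx.
  have nx := root_poset_nonneg xJ.
  have [/existsP[i /andP[iJ' ci]]|/existsPn H] :=
    boolP [exists i, (i \notin J') && (co i (val x) != 0)]; last first.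
    case/negP: xNJ'; rewrite inE nx andbT; apply/mem_parabolic => i iJ'.
    by have := H i; rewrite iJ' => /negPn/eqP.
  have iJ : i \in J.
    apply: contraNT ci => iJ; move: xJ; rewrite inE => /andP[/mem_parabolic-> //].
  exists (SeqSub (simple_in i)).
    rewrite in_setD; apply/andP; split.
      rewrite inE negb_and; apply/orP; left; apply/mem_parabolic => /(_ i iJ') /eqP.
      by rewrite coord_simple eqxx oner_eq0.
    rewrite inE nonneg_simple andbT; apply/mem_parabolic => j jJ /=.
    by rewrite coord_simple; case: eqP iJ jJ => // -> ->.
  apply/andP; split.
    apply/forallP => j; rewrite linearB /= coord_simple.
    have [<-|ij] := eqVneq i j; last by rewrite subr0 (forallP nx).
    move: ci; have /natrP[m ->] := forallP nx i; case: m => [|m _]; first by rewrite eqxx.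
    by rewrite -natrB // natr_nat.
  by apply: contraTneq rx => <-; rewrite /root_rank height_simple.
- exact: le_root_refl.
- exact: le_root_anti.
- exact: le_root_trans.
- exact: root_rank_lt.
Qed.

End Roots.

(** * Noncrossing partitions *)

Section Weyl.
Variables (K : archiRealFieldType) (n r : nat).
Variables (Phi : seq 'cV[K]_n) (alpha : r.-tuple 'cV[K]_n).
Hypothesis Phi_rs : root_system Phi.
Hypothesis alpha_ss : simple_system Phi alpha.

Local Notation root := (seq_sub Phi).
Local Notation sr := (tnth alpha).
Local Notation co := (coord alpha).
Local Notation s_ := (simple_refl alpha).
Local Notation PhiJ := (parabolic_roots Phi alpha).
Local Notation Rprod := (reflection_product Phi alpha).
Implicit Types (i j : 'I_r) (J X Y : {set 'I_r}) (g w u : 'M[K]_n) (v : 'cV[K]_n).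

Lemma orthogonal_mulmxV g : orthogonal_mx g -> g *m invmx g = 1%:M.
Proof. by move/orthogonal_unitmx/mulmxV. Qed.

Lemma orthogonal_invmxM g w : orthogonal_mx g -> orthogonal_mx w ->
  invmx (g *m w) = invmx w *m invmx g.
Proof.
by move=> Hg Hw; rewrite !orthogonal_invmx ?orthogonal_mxM // trmx_mul.
Qed.

Lemma orthogonal_invmx_orth g : orthogonal_mx g -> orthogonal_mx (invmx g).
Proof.
by move=> Hg; rewrite orthogonal_invmx // /orthogonal_mx trmxK (mulmx1C (eqP Hg)).
Qed.

Lemma big_mulmx_cat (I : Type) (s t : seq I) (F : I -> 'M[K]_n) :
  \big[mulmx/1%:M]_(i <- s ++ t) F i =
  (\big[mulmx/1%:M]_(i <- s) F i) *m (\big[mulmx/1%:M]_(i <- t) F i).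
Proof.
elim: s => [|i s IHs]; first by rewrite big_nil mul1mx.
by rewrite cat_cons !big_cons IHs mulmxA.
Qed.

Lemma weyl1 J : weyl alpha J 1%:M.
Proof. by exists [::]; rewrite ?big_nil. Qed.

Lemma weylM J u w : weyl alpha J u -> weyl alpha J w -> weyl alpha J (u *m w).
Proof.
case=> s sJ -> [t tJ ->]; exists (s ++ t); last by rewrite big_mulmx_cat.
by move=> i; rewrite mem_cat => /orP[/sJ|/tJ].
Qed.

Lemma weyl_simple J i : i \in J -> weyl alpha J (s_ i).
Proof.
move=> iJ; exists [:: i]; last by rewrite big_cons big_nil mulmx1.
by move=> j; rewrite inE => /eqP->.
Qed.

Lemma weyl_ind J (E : 'M[K]_n -> Prop) : E 1%:M ->
  (forall i w, i \in J -> weyl alpha J w -> E w -> E (s_ i *m w)) ->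
  forall w, weyl alpha J w -> E w.
Proof.
move=> E1 ES w [s + ->]; elim: s => [|i s IHs] sJ; first by rewrite big_nil.
have sJ' : {subset s <= J} by move=> j js; apply: sJ; rewrite inE js orbT.
rewrite big_cons; apply: ES; [by apply: sJ; rewrite mem_head|by exists s|].
exact: IHs.
Qed.

Lemma weyl_orthogonal J w : weyl alpha J w -> orthogonal_mx w.
Proof.
apply: (weyl_ind (E := @orthogonal_mx K n)) => [|i u _ _]; first exact: orthogonal_mx1.
exact/orthogonal_mxM/orthogonal_reflection.
Qed.

Lemma weyl_inv J w : weyl alpha J w -> weyl alpha J (invmx w).
Proof.
move=> Hw; rewrite orthogonal_invmx ?(weyl_orthogonal Hw) //.
move: w Hw; apply: weyl_ind => [|i w iJ _ IH]; first by rewrite trmx1; apply: weyl1.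
by rewrite trmx_mul tr_reflection; apply: weylM IH (weyl_simple iJ).
Qed.

Lemma weyl_cox J X : X \subset J -> weyl alpha J (cox_part alpha X).
Proof.
move=> /subsetP sX; exists [seq i <- index_enum 'I_r | i \in X].
  by move=> i; rewrite mem_filter => /andP[/sX].
by rewrite big_filter.
Qed.

Lemma weyl_coxeter L R J : weyl alpha J (coxeter alpha L R J).
Proof. by apply: weylM; apply: weyl_cox; apply: subsetIr. Qed.

Lemma parabolic_roots_sub J' J : J' \subset J -> PhiJ J' \subset PhiJ J.
Proof.
move=> /subsetP sJ; apply/subsetP => b /(mem_parabolic alpha_ss) bJ.
by apply/(mem_parabolic alpha_ss) => i iJ; apply: bJ; apply: contra iJ => /sJ.
Qed.

Lemma coord_simple_refl i j v : j != i -> co j (s_ i *m v) = co j v.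
Proof.
move=> ji; rewrite reflectionE linearB linearZ /= (coord_simple alpha_ss).
by rewrite eq_sym (negPf ji) mulr0 subr0.
Qed.

Lemma weyl_root J w b : weyl alpha J w -> b \in Phi -> w *m b \in Phi.
Proof.
move=> Hw bP; move: w Hw; apply: weyl_ind => [|i w _ _ IH]; first by rewrite mul1mx.
by rewrite -mulmxA; apply: root_reflection => //; apply: simple_in.
Qed.

Lemma weyl_parabolic J w (b : root) : weyl alpha J w -> b \in PhiJ J ->
  exists2 b', b' \in PhiJ J & val b' = w *m val b.
Proof.
move=> Hw /(mem_parabolic alpha_ss) bJ.
exists (SeqSub (weyl_root Hw (valP b))) => //.
apply/(mem_parabolic alpha_ss) => j jJ /=.
move: w Hw; apply: weyl_ind => [|i w iJ _ IH]; first by rewrite mul1mx bJ.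
by rewrite -mulmxA coord_simple_refl ?IH //; apply: contraNneq jJ => ->.
Qed.

Lemma Rprod_conj J k g w : weyl alpha J g -> Rprod J k w ->
  Rprod J k (g *m w *m invmx g).
Proof.
move=> Hg [t [<- tJ ->]] {k w}; have og := weyl_orthogonal Hg.
elim: t tJ => [|b t IHt] tJ.
  by exists [::]; rewrite !big_nil mulmx1 orthogonal_mulmxV.
have [b' b'J eb'] := weyl_parabolic Hg (tJ b (mem_head _ _)).
have [|t' [st' t'J et']] := IHt; first by move=> x xt; apply: tJ; rewrite inE xt orbT.
exists (b' :: t'); split; first by rewrite /= st'.
  by move=> x; rewrite inE => /orP[/eqP->|/t'J].
rewrite !big_cons -et' eb' (reflection_conj _ og) !mulmxA.
by rewrite (mulmxKV (orthogonal_unitmx og)).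
Qed.

Lemma Rprod_conj_iff J k g w : weyl alpha J g ->
  Rprod J k (g *m w *m invmx g) <-> Rprod J k w.
Proof.
move=> Hg; split; last exact: Rprod_conj.
move/(Rprod_conj (weyl_inv Hg)); have ug := orthogonal_unitmx (weyl_orthogonal Hg).
by rewrite invmxK !mulmxA mulVmx // mul1mx mulmxKV.
Qed.

Lemma Rprod_orthogonal J k w : Rprod J k w -> orthogonal_mx w.
Proof.
case=> t [_ _ ->]; elim: t => [|b t IHt]; first by rewrite big_nil orthogonal_mx1.
by rewrite big_cons orthogonal_mxM // orthogonal_reflection.
Qed.

Lemma RprodM J k l u w : Rprod J k u -> Rprod J l w -> Rprod J (k + l)%N (u *m w).
Proof.
case=> s [<- sJ ->] [t [<- tJ ->]]; exists (s ++ t); rewrite size_cat big_mulmx_cat.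
by split=> // i; rewrite mem_cat => /orP[/sJ|/tJ].
Qed.

Lemma Rprod1 J (b : root) : b \in PhiJ J -> Rprod J 1 (reflection (val b)).
Proof.
move=> bJ; exists [:: b]; rewrite big_cons big_nil mulmx1; split=> // x.
by rewrite inE => /eqP->.
Qed.

Lemma Rprod0 J : Rprod J 0 1%:M.
Proof. by exists [::]; rewrite big_nil. Qed.

Lemma Rprod_inv J k w : Rprod J k w -> Rprod J k (invmx w).
Proof.
move=> Hw; rewrite orthogonal_invmx ?(Rprod_orthogonal Hw) //.
case: Hw => t [<- tJ ->] {k w}; elim: t tJ => [|b t IHt] tJ.
  by rewrite big_nil trmx1; apply: Rprod0.
rewrite big_cons trmx_mul tr_reflection /= -addn1; apply: RprodM.
  by apply: IHt => x xt; apply: tJ; rewrite inE xt orbT.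
by apply/Rprod1/tJ; rewrite mem_head.
Qed.

Lemma Rprod_sub J' J k w : J' \subset J -> Rprod J' k w -> Rprod J k w.
Proof.
move=> /parabolic_roots_sub/subsetP sJ [t [st tJ ->]].
by exists t; split=> // b /tJ/sJ.
Qed.

Lemma abs_length_iff J k u w : (forall m, Rprod J m u <-> Rprod J m w) ->
  abs_length Phi alpha J u k <-> abs_length Phi alpha J w k.
Proof. by move=> H; split=> -[/H ? min_]; split=> // m /H /min_. Qed.

Lemma abs_length_conj J k g w : weyl alpha J g ->
  abs_length Phi alpha J (g *m w *m invmx g) k <-> abs_length Phi alpha J w k.
Proof. by move=> Hg; apply: abs_length_iff => m; apply: Rprod_conj_iff. Qed.

Lemma abs_length_inv J k w :
  abs_length Phi alpha J (invmx w) k <-> abs_length Phi alpha J w k.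
Proof.
by apply: abs_length_iff => m; split=> /Rprod_inv; rewrite ?invmxK.
Qed.

Lemma abs_le1 J k w : abs_length Phi alpha J w k -> abs_le Phi alpha J 1%:M w.
Proof.
move=> Hw; exists 0%N, k; rewrite invmx1 mul1mx; split=> //.
by split=> //; apply: Rprod0.
Qed.

(** s_i changes only the i-th coordinate. If s_i b were negative, the other coordinates of b would
    vanish, and reducedness would make b equal to alpha_i. *)
Lemma nonneg_root_simple_refl b i : b \in Phi -> nonneg_simple_sum alpha b ->
  b != sr i -> nonneg_simple_sum alpha (s_ i *m b).
Proof.
move=> bP nb bi; have sP : s_ i *m b \in Phi.
  by apply: root_reflection => //; apply: simple_in.
have [//|nsb] := root_sign alpha_ss sP.
suff e : b = co i b *: sr i.
  have kP : co i b *: sr i \in Phi by rewrite -e.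
  case: (root_reduced Phi_rs (simple_in alpha_ss i) kP) => k; first by rewrite e k scale1r eqxx in bi.
  by have := natr_ge0 (forallP nb i); rewrite k oppr_ge0 ler10.
rewrite {1}(root_expand alpha_ss bP) (bigD1 i) //= big1 ?addr0 // => j ji.
suff -> : co j b = 0 by rewrite scale0r.
apply/le_anti; rewrite (natr_ge0 (forallP nb j)) andbT.
by have := natr_ge0 (forallP nsb j); rewrite linearN /= coord_simple_refl // oppr_ge0.
Qed.

(** [weyl] is generated by simple reflections; this brings in the others. A positive root that is
    not simple loses height under a simple reflection with positive inner product, and conjugation
    undoes that step. *)
Lemma weyl_reflection J (b : root) : b \in PhiJ J -> weyl alpha J (reflection (val b)).
Proof.
suff H m (c : root) : (height alpha (val c) <= m)%N -> nonneg_simple_sum alpha (val c) ->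
    c \in PhiJ J -> weyl alpha J (reflection (val c)).
  move=> bJ; have [nb|nb] := root_sign alpha_ss (valP b); first exact: H nb bJ.
  rewrite -reflectionN; apply: (H _ (SeqSub (root_opp Phi_rs (valP b)))) (leqnn _) nb _.
  apply/(mem_parabolic alpha_ss) => i iJ; rewrite linearN /=.
  by rewrite (mem_parabolic alpha_ss _ _ bJ) ?oppr0.
elim: m c => [|m IHm] c hc nc cJ.
  have := height_gt0 (root_expand alpha_ss (valP c)) nc (root_nonzero Phi_rs (valP c)).
  by rewrite ltnNge hc.
have [i ci di] := nonneg_coord_gt0 (root_expand alpha_ss (valP c)) nc
  (root_nonzero Phi_rs (valP c)).
have iJ : i \in J.
  by apply: contraTT ci => iJ; rewrite (mem_parabolic alpha_ss _ _ cJ) // ltxx.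
have [->|cni] := eqVneq (val c) (sr i); first exact: weyl_simple.
have Hi := weyl_simple iJ.
have [c' c'J ec'] := weyl_parabolic Hi cJ.
have -> : val c = s_ i *m val c' by rewrite ec' mulmxA reflectionK mul1mx.
rewrite reflection_conj ?(weyl_orthogonal Hi) //.
have nc' : nonneg_simple_sum alpha (val c').
  by rewrite ec'; apply: nonneg_root_simple_refl => //; apply: valP.
apply: weylM (weyl_inv Hi); apply: weylM Hi _; apply: IHm => //.
rewrite -ltnS (leq_trans _ hc) //.
rewrite -(ltr_nat K) !heightE // ec' [X in X < _](bigD1 i) //= [X in _ < X](bigD1 i) //=.
rewrite (eq_bigr (fun j => co j (val c))) => [|j ji]; last exact: coord_simple_refl.
rewrite ltrD2r reflectionE linearB linearZ /= (coord_simple alpha_ss) eqxx mulr1.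
rewrite ltrBlDr ltrDl divr_gt0 ?mulr_gt0 //; first by rewrite dotC.
by rewrite dotvv_gt0; apply/(root_nonzero Phi_rs)/simple_in.
Qed.

Lemma Rprod_weyl J k w : Rprod J k w -> weyl alpha J w.
Proof.
case=> t [_ + ->] {k w}; elim: t => [|b t IHt] tJ; first by rewrite big_nil; apply: weyl1.
rewrite big_cons; apply: weylM; first by apply/weyl_reflection/tJ; rewrite mem_head.
by apply: IHt => x xt; apply: tJ; rewrite inE xt orbT.
Qed.

(* These matrices annihilate each other for orthogonal simple roots, which makes
   [1 - cox_part X] additive in [X]. *)
Definition refl_defect i : 'M[K]_n := 1%:M - s_ i.

Definition independent X := {in X &, forall i j, ~~ dynkin_edge alpha i j}.

Lemma independent_dot X i j : independent X -> i \in X -> j \in X -> i != j ->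
  dot (sr i) (sr j) = 0.
Proof.
by move=> iX /iX H /H; rewrite /dynkin_edge negb_and !negbK => /orP[/eqP->|/eqP//]; rewrite eqxx.
Qed.

Lemma refl_defectE i v :
  refl_defect i *m v = (2 * dot (sr i) v / dot (sr i) (sr i)) *: sr i.
Proof. by rewrite /refl_defect mulmxBl mul1mx reflectionE subKr. Qed.

Lemma refl_defectM i j : dot (sr i) (sr j) = 0 -> refl_defect i *m refl_defect j = 0.
Proof.
move=> d0; rewrite {2}/refl_defect /simple_refl /reflection subKr -scalemxAr mulmxA.
by rewrite refl_defectE d0 mulr0 mul0r scale0r mul0mx scaler0.
Qed.

Lemma big_simple_refl (s : seq 'I_r) X : independent X -> uniq s -> {subset s <= X} ->
  \big[mulmx/1%:M]_(i <- s) s_ i = 1%:M - \sum_(i <- s) refl_defect i.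
Proof.
move=> iX; elim: s => [|i s IHs] /=; first by rewrite !big_nil subr0.
case/andP=> is_ us sX; rewrite !big_cons IHs //; last first.
  by move=> j js; apply: sX; rewrite inE js orbT.
have -> : s_ i = 1%:M - refl_defect i by rewrite subKr.
have z : \sum_(j <- s) refl_defect i *m refl_defect j = 0.
  rewrite big_seq big1 // => j js; apply/refl_defectM/(independent_dot iX).
  - by apply: sX; rewrite mem_head.
  - by apply: sX; rewrite inE js orbT.
  - by apply: contraNneq is_ => ->.
by rewrite mulmxBr mulmx1 mulmxBl mul1mx mulmx_sumr z subr0 [in RHS]opprD addrA.
Qed.

Lemma cox_partE X : independent X ->
  cox_part alpha X = 1%:M - \sum_(i in X) refl_defect i.
Proof.
move=> iX; have uX : uniq [seq i <- index_enum 'I_r | i \in X].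
  by rewrite filter_uniq // index_enum_uniq.
rewrite /cox_part -big_filter -[in RHS]big_filter.
by apply: (big_simple_refl iX) => // i; rewrite mem_filter => /andP[].
Qed.

Lemma cox_partEmul X v : independent X -> cox_part alpha X *m v =
  v - \sum_(i in X) (2 * dot (sr i) v / dot (sr i) (sr i)) *: sr i.
Proof.
move=> iX; rewrite cox_partE // mulmxBl mul1mx mulmx_suml.
by congr (_ - _); apply: eq_bigr => i _; rewrite refl_defectE.
Qed.

Lemma independent_sub X Y : Y \subset X -> independent X -> independent Y.
Proof. by move=> /subsetP sY iX i j /sY iX' /sY; apply: iX. Qed.

Lemma cox_part_setU X Y : independent (X :|: Y) -> [disjoint X & Y] ->
  cox_part alpha (X :|: Y) = cox_part alpha X *m cox_part alpha Y.
Proof.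
move=> iXY dXY; rewrite !cox_partE //; try by apply: independent_sub iXY;
  rewrite ?subsetUl ?subsetUr.
have z : (\sum_(i in X) refl_defect i) *m (\sum_(j in Y) refl_defect j) = 0.
  rewrite mulmx_suml big1 // => i iX; rewrite mulmx_sumr big1 // => j jY.
  apply/refl_defectM/(independent_dot iXY); rewrite ?inE ?iX ?jY ?orbT //.
  by apply: contraTneq jY => <-; rewrite (disjointFr dXY).
rewrite mulmxBr mulmx1 mulmxBl mul1mx z subr0.
rewrite (eq_bigl [predU X & Y]) => [|i]; last by rewrite !inE.
by rewrite bigU //= opprD addrA.
Qed.

Lemma cox_part1 i : cox_part alpha [set i] = s_ i.
Proof.
rewrite cox_partE ?big_set1 ?subKr // => j k; rewrite !inE => /eqP-> /eqP->.
by rewrite /dynkin_edge eqxx.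
Qed.

Lemma cox_part0 : cox_part alpha set0 = 1%:M.
Proof. by rewrite /cox_part big_set0. Qed.

Lemma cox_part_sq X : independent X -> cox_part alpha X *m cox_part alpha X = 1%:M.
Proof.
move: {2}#|X| (erefl #|X|) => m; elim: m X => [|m IHm] X cX iX.
  by rewrite (cards0_eq cX) cox_part0 mul1mx.
have [i iInX] : exists i, i \in X by apply/card_gt0P; rewrite cX.
have iX' : independent (X :\ i) by apply: independent_sub iX; apply: subD1set.
have di : [disjoint [set i] & X :\ i] by rewrite disjoints1 !inE eqxx.
have e1 : cox_part alpha X = s_ i *m cox_part alpha (X :\ i).
  by rewrite -{1}(setD1K iInX) cox_part_setU ?setD1K // cox_part1.
have e2 : cox_part alpha X = cox_part alpha (X :\ i) *m s_ i.
  by rewrite -{1}(setD1K iInX) setUC cox_part_setU ?cox_part1 1?setUC ?setD1K // disjoint_sym.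
rewrite {1}e2 e1 mulmxA -(mulmxA _ (s_ i) (s_ i)) reflectionK mulmx1 IHm //.
by move: cX; rewrite (cardsD1 i) iInX => -[].
Qed.

Lemma cox_part_inv X : independent X -> invmx (cox_part alpha X) = cox_part alpha X.
Proof.
move=> iX; have sq := cox_part_sq iX; have [u _] := mulmx1_unit sq.
by rewrite -[RHS]mul1mx -(mulVmx u) -mulmxA sq mulmx1.
Qed.

Lemma coord_cox_part X k v : independent X -> k \notin X ->
  co k (cox_part alpha X *m v) = co k v.
Proof.
move=> iX kX; rewrite cox_partEmul // linearB linear_sum big1 ?subr0 // => i iX'.
by rewrite linearZ /= (coord_simple alpha_ss); case: eqP iX' kX => [->->|]; rewrite ?mulr0.
Qed.

(** c_X only changes coordinates in X, so b is supported on X. These simple roots are orthogonal,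
    hence s_i negates the i-th coordinate of b, which is impossible for a positive root other than
    alpha_i. *)
Lemma root_negated_by_cox_part X b : independent X -> b \in Phi ->
  nonneg_simple_sum alpha b -> nonneg_simple_sum alpha (- (cox_part alpha X *m b)) ->
  exists2 i, i \in X & b = sr i.
Proof.
move=> iX bP nb nXb.
have b0 k : k \notin X -> co k b = 0.
  move=> kX; apply/le_anti; rewrite (natr_ge0 (forallP nb k)) andbT.
  by have := natr_ge0 (forallP nXb k); rewrite linearN /= coord_cox_part // oppr_ge0.
have [i ci _] := nonneg_coord_gt0 (root_expand alpha_ss bP) nb (root_nonzero Phi_rs bP).
have iInX : i \in X by apply: contraTT ci => /b0->; rewrite ltxx.
exists i => //; apply/eqP/negPn/negP => bi.
have di : dot (sr i) (sr i) != 0.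
  by rewrite dotvv_eq0; apply/(root_nonzero Phi_rs)/simple_in.
have := natr_ge0 (forallP (nonneg_root_simple_refl bP nb bi) i).
rewrite reflectionE linearB linearZ /= (coord_simple alpha_ss) eqxx mulr1.
have -> : dot (sr i) b = co i b * dot (sr i) (sr i).
  rewrite {1}(root_expand alpha_ss bP) dot_sumr (bigD1 i) //= dotZr big1 ?addr0 //.
  move=> j ji; rewrite dotZr; have [jX|jX] := boolP (j \in X); last by rewrite b0 ?mul0r.
  by rewrite (independent_dot iX) ?mulr0 // eq_sym.
rewrite mulrA mulfK // subr_ge0 mulr2n mulrDl mul1r gerDl.
by rewrite leNgt ci.
Qed.

(** * The bipartite Coxeter elements of the parabolic subgroups *)

Variables (L R : {set 'I_r}).
Hypothesis LR : dynkin_bipartition alpha L R.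

Local Notation cox := (coxeter alpha L R).

Lemma independent_L J : independent (L :&: J).
Proof. by apply: independent_sub (bipart_left LR); apply: subsetIl. Qed.

Lemma independent_R J : independent (R :&: J).
Proof. by apply: independent_sub (bipart_right LR); apply: subsetIl. Qed.

Lemma bipart_split i : (i \in R) = (i \notin L).
Proof.
have := in_setT i; rewrite -(bipart_cover LR) inE.
have [iL _|//] := boolP (i \in L).
by rewrite (disjointFr (bipart_disjoint LR)).
Qed.

(** As c_L is an involution, c v = v means c_R v = c_L v. Then v - c_R v and v - c_L v are equal
    combinations of disjoint sets of simple roots, so every coefficient vanishes. *)
Lemma coxeter_fixed J v i : cox J *m v = v -> i \in J -> dot (sr i) v = 0.
Proof.
move=> e iJ.
have {}e : cox_part alpha (R :&: J) *m v = cox_part alpha (L :&: J) *m v.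
  by rewrite -{2}e /coxeter -mulmxA mulmxA (cox_part_sq (@independent_L J)) mul1mx.
move: e; rewrite !cox_partEmul; [|exact: independent_L|exact: independent_R].
move/addrI/oppr_inj/(congr1 (co i)); rewrite !linear_sum /=.
have E X : \sum_(k in X) co i ((2 * dot (sr k) v / dot (sr k) (sr k)) *: sr k) =
    if i \in X then 2 * dot (sr i) v / dot (sr i) (sr i) else 0.
  case: ifP => iX.
    rewrite (bigD1 i) //= big1 ?addr0 => [|k /andP[_ ki]].
      by rewrite linearZ /= (coord_simple alpha_ss) eqxx mulr1.
    by rewrite linearZ /= (coord_simple alpha_ss) (negPf ki) mulr0.
  rewrite big1 // => k kX; rewrite linearZ /= (coord_simple alpha_ss).
  by case: eqP kX iX => [->->|]; rewrite ?mulr0.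
have d0 : dot (sr i) (sr i) != 0.
  by rewrite dotvv_eq0; apply/(root_nonzero Phi_rs)/simple_in.
have z : 2 * dot (sr i) v / dot (sr i) (sr i) = 0 -> dot (sr i) v = 0.
  move/eqP; rewrite mulf_eq0 invr_eq0 (negPf d0) orbF mulf_eq0 pnatr_eq0 /=.
  by move/eqP.
rewrite !E !in_setI iJ !andbT bipart_split.
by case: (i \in L) => /= [/esym|]; apply: z.
Qed.

Lemma dim_parabolic_span J : \dim <<[seq sr i | i in J]>> = #|J|.
Proof.
have [_ fr _] := alpha_ss; rewrite cardE -(size_map sr); apply/eqP.
rewrite -/(free _).
have sr_inj : injective sr.
  move=> i j; rewrite !(tnth_nth 0) => /eqP.
  by rewrite nth_uniq ?size_tuple ?(free_uniq fr) // => /eqP/val_inj.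
suff -> : [seq sr i | i in J] = [seq v <- alpha | v \in [seq sr i | i in J]].
  exact: filter_free.
rewrite -[X in filter _ X]map_tnth_enum filter_map /image_mem; congr map.
rewrite [in RHS]enumT; apply: eq_filter => i /=.
by rewrite (mem_map sr_inj) mem_enum.
Qed.

(* Carter's argument: a vector orthogonal to all the roots of [t] is fixed by the
   product, hence orthogonal to the span of J; conclude by comparing dimensions. *)
Lemma coxeter_factors_parabolic J (t : seq root) :
  \big[mulmx/1%:M]_(b <- t) reflection (val b) = cox J -> (size t <= #|J|)%N ->
  {subset t <= PhiJ J}.
Proof.
move=> et st b bt.
suff e : <<[seq sr i | i in J]>>%VS = <<[seq val x | x <- t]>>%VS.
  by rewrite inE e memv_span // map_f.
apply/eqP; rewrite eqEdim dim_parabolic_span (leq_trans (dim_span _)) ?size_map // andbT.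
apply/span_subvP => _ /imageP[i iJ ->]; apply: mem_span_orthogonal => v tv.
apply: (@coxeter_fixed J) => //; rewrite -et.
elim: (t) tv => [|x s IHs] sv; first by rewrite big_nil mul1mx.
rewrite big_cons -mulmxA IHs; last by move=> y ys; apply: sv; rewrite inE ys orbT.
by rewrite reflectionE sv ?mem_head // mulr0 mul0r scale0r subr0.
Qed.

(* The sum of the orbit of b under c is fixed by c, hence zero. *)
Lemma coxeter_orbit_negative J (b : root) : b \in PhiJ J ->
  exists m, ~~ nonneg_simple_sum alpha (iter m (mulmx (cox J)) (val b)).
Proof.
move=> bJ; set c := cox J; have Wc : weyl alpha J c by apply: weyl_coxeter.
(* c maps roots to roots, so [insubd] never falls back on its default; in the finite type of roots
   the orbit of [b] closes up after [order f b] steps. *)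
pose f (x : root) : root := insubd x (c *m val x).
have fE x : val (f x) = c *m val x by rewrite val_insubd (weyl_root Wc (valP x)).
have f_inj : injective f.
  move=> x y /(congr1 val); rewrite !fE => /(congr1 (mulmx (invmx c))).
  by rewrite !mulKmx ?(orthogonal_unitmx (weyl_orthogonal Wc)) // => /val_inj.
have fm m : val (iter m f b) = iter m (mulmx c) (val b).
  by elim: m => // m IHm; rewrite !iterS fE IHm.
have fJ m : iter m f b \in PhiJ J.
  elim: m => //= m IHm; have [x xJ ex] := weyl_parabolic Wc IHm.
  by rewrite (_ : f _ = x) //; apply: val_inj; rewrite fE.
have [/existsP[m Hm]|/existsPn H] := boolP [exists m : 'I_(order f b),
    ~~ nonneg_simple_sum alpha (iter m (mulmx c) (val b))]; first by exists m.
pose S := \sum_(m < order f b) val (iter m f b).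
have cS : c *m S = S.
  rewrite /S mulmx_sumr; under eq_bigr do rewrite -fE -iterS.
  rewrite -[RHS](big_mkord xpredT (fun m => val (iter m f b))).
  rewrite -(big_mkord xpredT (fun m => val (iter m.+1 f b))).
  have := order_gt0 f b; case E: (order f b) => [//|N] _.
  rewrite big_nat_recr // [RHS]big_nat_recl //= addrC; congr (_ + _).
  by rewrite -iterS -E iter_order.
have eS : S = \sum_i co i S *: sr i.
  transitivity (\sum_(m < order f b) \sum_i co i (val (iter m f b)) *: sr i).
    by apply: eq_bigr => m _; apply/root_expand/valP.
  rewrite exchange_big; apply: eq_bigr => i _.
  by rewrite /S linear_sum scaler_suml.
have zS i : i \notin J -> co i S = 0.
  by move=> iJ; rewrite /S linear_sum big1 // => m _; apply: (mem_parabolic alpha_ss _ _ (fJ m)).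
have S0 : S = 0.
  apply/eqP; rewrite -dotvv_eq0 {2}eS dot_sumr big1 // => i _; rewrite dotZr.
  have [iJ|iJ] := boolP (i \in J); last by rewrite zS ?mul0r.
  by rewrite dotC (coxeter_fixed cS iJ) mulr0.
have nm (m : 'I_(order f b)) : nonneg_simple_sum alpha (val (iter m f b)).
  by have := H m; rewrite negbK fm.
have ob := order_gt0 f b; have nb := nm (Ordinal ob).
have [i ci _] := nonneg_coord_gt0 (root_expand alpha_ss (valP b)) nb
  (root_nonzero Phi_rs (valP b)).
have : 0 < co i S.
  rewrite /S linear_sum (bigD1 (Ordinal ob)) //= ltr_wpDr // sumr_ge0 // => m _.
  exact: natr_ge0 (forallP (nm m) i).
by rewrite S0 linear0 ltxx.
Qed.

Lemma weyl_iter J g m : weyl alpha J g -> weyl alpha J (iter m (mulmx g) 1%:M).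
Proof. by move=> Hg; elim: m => [|m IHm]; [apply: weyl1|apply: weylM]. Qed.

Lemma iter_mulmx p g m (A : 'M[K]_(n, p)) :
  iter m (mulmx g) A = iter m (mulmx g) 1%:M *m A.
Proof. by elim: m => [|m IHm]; rewrite /= ?mul1mx // IHm mulmxA. Qed.

(* The vectors on the right are the inversions of c: the orbit of b has a positive
   root sent to a negative one. *)
Lemma coxeter_orbit_simple J (b : root) : b \in PhiJ J ->
  exists m, (exists2 j, j \in R :&: J & iter m (mulmx (cox J)) (val b) = sr j) \/
    (exists2 i, i \in L :&: J &
       iter m (mulmx (cox J)) (val b) = cox_part alpha (R :&: J) *m sr i).
Proof.
move=> bJ; set c := cox J; have Wc : weyl alpha J c by apply: weyl_coxeter.
have Wm m := weyl_iter m Wc.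
have Pm m (x : root) : iter m (mulmx c) (val x) \in Phi.
  by rewrite iter_mulmx (weyl_root (Wm m) (valP x)).
(* A negative member of the orbit of -b gives a positive member of the orbit of b. Starting there,
   the first negative root is preceded by a positive one. *)
have [m0 nm0] : exists m0, nonneg_simple_sum alpha (iter m0 (mulmx c) (val b)).
  have bJ' : SeqSub (root_opp Phi_rs (valP b)) \in PhiJ J.
    apply/(mem_parabolic alpha_ss) => i iJ; rewrite linearN /=.
    by rewrite (mem_parabolic alpha_ss _ _ bJ) ?oppr0.
  have [m Hm] := coxeter_orbit_negative bJ'; exists m.
  have [//|nm] := root_sign alpha_ss (Pm m b).
  by move: Hm; rewrite iter_mulmx /= mulmxN -iter_mulmx nm.
have [b0 b0J eb0] := weyl_parabolic (Wm m0) bJ; rewrite -iter_mulmx in eb0.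
have [m1 Hm1 min_m1] := ex_minnP (coxeter_orbit_negative b0J).
case: m1 Hm1 min_m1 => [|m1] Hm1 min_m1; first by rewrite /= eb0 nm0 in Hm1.
exists (m1 + m0)%N; rewrite iterD -eb0.
have nb1 : nonneg_simple_sum alpha (iter m1 (mulmx c) (val b0)).
  by apply/negPn/negP => /min_m1; rewrite ltnn.
move: (Pm m1 b0) (Pm m1.+1 b0) nb1 Hm1 => /=; rewrite -/c.
move: (iter m1 _ _) => b1 b1P cb1P nb1 ncb1.
have {}ncb1 : nonneg_simple_sum alpha (- (c *m b1)).
  by case: (root_sign alpha_ss cb1P) => // h; rewrite h in ncb1.
have WR : weyl alpha J (cox_part alpha (R :&: J)) by apply: weyl_cox; apply: subsetIr.
have dP := weyl_root WR b1P.
(* c_R acts first: either c_L makes c_R b1 negative, or c_R b1 is negative already. In both cases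
   the root being negated is simple. *)
have [nd|nd] := root_sign alpha_ss dP.
  have [|i iL ei] := root_negated_by_cox_part (@independent_L J) dP nd _.
    by rewrite mulmxA.
  right; exists i => //.
  by rewrite -ei mulmxA (cox_part_sq (@independent_R J)) mul1mx.
left; have [j jR ej] := root_negated_by_cox_part (@independent_R J) b1P nb1 nd.
by exists j.
Qed.

Lemma cox_part_D1 X i : independent X -> i \in X ->
  (cox_part alpha X = s_ i *m cox_part alpha (X :\ i)) *
  (cox_part alpha X = cox_part alpha (X :\ i) *m s_ i).
Proof.
move=> iX iInX; have di : [disjoint [set i] & X :\ i].
  by rewrite disjoints1 !inE eqxx.
split; rewrite -{1}(setD1K iInX).
  by rewrite cox_part_setU ?setD1K // cox_part1.
by rewrite setUC cox_part_setU ?cox_part1 1?setUC ?setD1K // disjoint_sym.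
Qed.

Lemma coxeter_D1_right J j : j \in R :&: J -> cox J *m s_ j = cox (J :\ j).
Proof.
move=> jRJ; have /setIP[jR jJ] := jRJ; rewrite /coxeter.
rewrite (cox_part_D1 (@independent_R J) jRJ).2 -!mulmxA reflectionK mulmx1.
congr (cox_part alpha _ *m cox_part alpha _); apply/setP => k; rewrite !inE.
  by have [->|//] := eqVneq k j; rewrite bipart_split in jR; rewrite (negPf jR).
by rewrite andbCA.
Qed.

Lemma coxeter_D1_left J i : i \in L :&: J -> cox J = s_ i *m cox (J :\ i).
Proof.
move=> iLJ; have /setIP[iL iJ] := iLJ; rewrite /coxeter.
rewrite (cox_part_D1 (@independent_L J) iLJ).1 -mulmxA.
congr (_ *m (cox_part alpha _ *m cox_part alpha _)); apply/setP => k; rewrite !inE.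
  by rewrite andbCA.
by have [->|//] := eqVneq k i; rewrite bipart_split iL.
Qed.

(** This bounds the absolute length of c by |J|, as the dimension count in
    [coxeter_factors_parabolic] requires. *)
Lemma Rprod_coxeter J : Rprod J #|J| (cox J).
Proof.
have RX X : X \subset J -> independent X -> Rprod J #|X| (cox_part alpha X).
  move: {2}#|X| (erefl #|X|) => m; elim: m X => [|m IHm] X cX sX iX.
    by rewrite cX (cards0_eq cX) cox_part0; apply: Rprod0.
  have [i iInX] : exists i, i \in X by apply/card_gt0P; rewrite cX.
  rewrite (cox_part_D1 iX iInX).1 (cardsD1 i) iInX; apply: RprodM.
    apply: (@Rprod1 _ (SeqSub (simple_in alpha_ss i))).
    apply/(mem_parabolic alpha_ss) => j jJ /=; rewrite (coord_simple alpha_ss).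
    by case: eqP jJ => // <-; rewrite (subsetP sX).
  apply: IHm.
  - by move: cX; rewrite (cardsD1 i) iInX => -[].
  - exact: subset_trans (subD1set _ _) sX.
  - by apply: independent_sub iX; apply: subD1set.
have -> : #|J| = (#|L :&: J| + #|R :&: J|)%N.
  rewrite -(cardsID L J) setIC; congr (_ + _)%N; apply: eq_card => i.
  by rewrite !inE bipart_split andbC.
apply: RprodM; apply: RX; rewrite ?subsetIr //.
  exact: independent_L.
exact: independent_R.
Qed.

Lemma noncrossing_step J w :
    noncrossing Phi alpha L R J w -> w <> cox J ->
  exists m i, let g := iter m (mulmx (cox J)) 1%:M in
    i \in J /\ noncrossing Phi alpha L R (J :\ i) (g *m w *m invmx g).
Proof.
case=> Ww _ [k [l [[Rw minw] [Rwc minwc] [Rc minc]]]] nwc.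
set c := cox J in Rwc minwc Rc minc nwc *.
have Wc : weyl alpha J c by apply: weyl_coxeter.
have uw := orthogonal_unitmx (weyl_orthogonal Ww).
have [t2 [st2 t2J et2]] := Rwc.
(* The last factor [b] of a shortest factorisation of w^-1 c is the reflection to split off; an
   empty factorisation would force w = c. *)
case/lastP: t2 st2 t2J et2 => [|t3 b] st2 t2J et2.
  case: nwc; rewrite big_nil in et2.
  by rewrite -[c](mulKVmx uw) et2 mulmx1.
have bJ : b \in PhiJ J by apply: t2J; rewrite mem_rcons mem_head.
have t3J : {subset t3 <= PhiJ J}.
  by move=> x xt; apply: t2J; rewrite mem_rcons inE xt orbT.
rewrite size_rcons in st2.
set u := \big[mulmx/1%:M]_(x <- t3) reflection (val x).
have wub : w *m u *m reflection (val b) = c.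
  rewrite -[c](mulKVmx uw) et2 -cats1 big_mulmx_cat big_cons big_nil mulmx1.
  by rewrite mulmxA.
have Ru : Rprod J (size t3) u by exists t3.
have Rb := Rprod1 bJ.
have [m Hm] := coxeter_orbit_simple bJ.
set g := iter m (mulmx c) 1%:M.
have Wg : weyl alpha J g by apply: weyl_iter.
have ug := orthogonal_unitmx (weyl_orthogonal Wg).
have cg : g *m c *m invmx g = c.
  suff -> : g *m c = c *m g by rewrite mulmxK.
  rewrite /g; elim: (m) => [|p IHp] /=; first by rewrite mul1mx mulmx1.
  by rewrite -mulmxA IHp.
(* For j in R, s_j cancels at the right end of c. For i in L, c c_R s_i c_R = c_L s_i c_R, and s_i
   cancels inside c_L. *)
have [i iJ ei] : exists2 i, i \in J & c *m reflection (g *m val b) = cox (J :\ i).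
  rewrite -iter_mulmx; case: Hm => -[i iX ->]; have /setIP[iLR iJ] := iX; exists i => //.
    exact: coxeter_D1_right.
  rewrite reflection_conj ?cox_part_inv; try exact: independent_R; last first.
    by apply: (@weyl_orthogonal J); apply: weyl_cox; apply: subsetIr.
  rewrite /c /coxeter !mulmxA -(mulmxA _ (cox_part _ _) (cox_part _ _)).
  rewrite cox_part_sq ?mulmx1; last exact: independent_R.
  have [e1 e2] := cox_part_D1 (@independent_L J) iX.
  rewrite {1}e2 -(mulmxA _ (s_ i) (s_ i)) reflectionK mulmx1.
  congr (cox_part alpha _ *m cox_part alpha _); apply/setP => j; rewrite !inE.
    by rewrite andbCA.
  by have [->|//] := eqVneq j i; rewrite bipart_split iLR.
exists m, i; split=> //; rewrite -/c -/g.
have sJ : J :\ i \subset J by apply: subD1set.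
set w' := g *m w *m invmx g; set u' := g *m u *m invmx g.
have ewu : w' *m u' = cox (J :\ i).
  rewrite -ei reflection_conj ?(weyl_orthogonal Wg) // -{1}cg -wub /w' /u'.
  rewrite !mulmxA !(mulmxKV ug) -(mulmxA _ (reflection _) (reflection _)).
  by rewrite reflectionK mulmx1.
have [t1' [st1' t1'J et1']] := Rprod_conj Wg Rw.
have [t3' [st3' t3'J et3']] := Rprod_conj Wg Ru.
(* Once [b] is dropped, at most |J| - 1 = |J - i| reflections multiply to c_(J - i), so all their
   roots lie in Phi_(J - i). *)
have kl : (k + (size t3).+1 <= #|J|)%N by rewrite st2; apply/minc/Rprod_coxeter.
have H : {subset t1' ++ t3' <= PhiJ (J :\ i)}.
  apply: coxeter_factors_parabolic.
    by rewrite big_mulmx_cat -et1' -et3'.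
  by rewrite size_cat st1' st3' -ltnS -addnS (leq_trans kl) // [in X in (X <= _)%N](cardsD1 i) iJ.
have Rw' : Rprod (J :\ i) k w'.
  by exists t1'; split=> // x xt; apply: H; rewrite mem_cat xt.
have Ru' : Rprod (J :\ i) (size t3) u'.
  by exists t3'; split=> // x xt; apply: H; rewrite mem_cat xt orbT.
have uw' : w' \in unitmx := orthogonal_unitmx (Rprod_orthogonal Rw').
have lw' : abs_length Phi alpha (J :\ i) w' k.
  by split=> // p /(Rprod_sub sJ)/(Rprod_conj_iff _ _ Wg)/minw.
have ubb : u *m reflection (val b) = invmx w *m c by rewrite -wub -mulmxA mulKmx.
split.
- exact: Rprod_weyl Rw'.
- exact: abs_le1 lw'.
(* Minimality passes down: a shorter factorisation over Phi_(J - i), conjugated back and followed by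
   [b], would shorten that of w^-1 c or of c. *)
exists k, (size t3); rewrite -/(coxeter alpha L R (J :\ i)) -ewu mulKmx //; split=> //.
  split=> // p /(Rprod_sub sJ)/(Rprod_conj_iff _ _ Wg) Hp.
  by have := RprodM Hp Rb; rewrite ubb => /minwc; rewrite -st2 addn1 ltnS.
split; first exact: RprodM.
move=> p /(Rprod_sub sJ); rewrite (_ : w' *m u' = g *m (w *m u) *m invmx g).
  move/(Rprod_conj_iff _ _ Wg) => Hp; have := RprodM Hp Rb.
  by rewrite wub => /minc; rewrite -st2 addnS addn1 ltnS.
by rewrite /w' /u' !mulmxA (mulmxKV ug).
Qed.

(** * Kreweras complement and Flip *)

Lemma noncrossing_weyl J w : noncrossing Phi alpha L R J w -> weyl alpha J w.
Proof. by case. Qed.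

Lemma weyl_cox_L J : weyl alpha J (cox_part alpha (L :&: J)).
Proof. by apply: weyl_cox; apply: subsetIr. Qed.

Lemma weyl_cox_R J : weyl alpha J (cox_part alpha (R :&: J)).
Proof. by apply: weyl_cox; apply: subsetIr. Qed.

Lemma coxeter_inv J :
  invmx (cox J) = cox_part alpha (R :&: J) *m cox_part alpha (L :&: J).
Proof.
rewrite /coxeter orthogonal_invmxM.
- by rewrite !cox_part_inv //; [exact: independent_L|exact: independent_R].
- exact: weyl_orthogonal (weyl_cox_L J).
- exact: weyl_orthogonal (weyl_cox_R J).
Qed.

Lemma Krew_sq J w : weyl alpha J w ->
  Krew alpha L R J (Krew alpha L R J w) = cox J *m w *m invmx (cox J).
Proof.
move=> Hw; rewrite /Krew orthogonal_invmxM ?invmxK ?mulmxA //.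
  exact: weyl_orthogonal (weyl_coxeter L R J).
exact: weyl_orthogonal (weyl_inv Hw).
Qed.

Definition FlipJ J w : 'M[K]_n :=
  cox_part alpha (L :&: J) *m invmx w *m cox_part alpha (L :&: J).

(** The left side is c c_L c w^-1 c_L, and c c_L c = c_L because c = c_L c_R with both factors
    involutions. *)
Lemma FlipJ_Krew J w : weyl alpha J w ->
  Krew alpha L R J (FlipJ J (Krew alpha L R J w)) = FlipJ J w.
Proof.
move=> Hw; have oc := weyl_orthogonal (weyl_coxeter L R J).
have oL := weyl_orthogonal (weyl_cox_L J).
have oR := weyl_orthogonal (weyl_cox_R J).
have ow := weyl_orthogonal Hw; have ow' := orthogonal_invmx_orth ow.
have sL := cox_part_sq (@independent_L J).
rewrite /Krew /FlipJ (orthogonal_invmxM oc ow') invmxK coxeter_inv.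
rewrite -!mulmxA sL mulmx1 (orthogonal_invmxM oL) ?orthogonal_mxM //.
rewrite (orthogonal_invmxM ow oR) !cox_part_inv; try exact: independent_L;
  try exact: independent_R.
rewrite /coxeter !mulmxA -(mulmxA _ (cox_part _ (R :&: J)) (cox_part _ (R :&: J))).
by rewrite (cox_part_sq (@independent_R J)) mulmx1.
Qed.

Lemma coxeter_neq1 J i : i \in J -> cox J <> 1%:M.
Proof.
move=> iJ e; have := @coxeter_fixed J (sr i) i; rewrite e mul1mx => /(_ erefl iJ)/eqP.
by rewrite dotvv_eq0; apply/negP/(root_nonzero Phi_rs)/simple_in.
Qed.

Lemma supp_sub J A : A \in nonnesting Phi alpha J -> supp alpha A \subset J.
Proof.
rewrite inE => /andP[/subsetP sA _]; apply/subsetP => i.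
rewrite inE => /exists_inP[a /sA]; rewrite inE => /andP[/(mem_parabolic alpha_ss) aJ _].
move=> /forallP/(_ i)/natr_ge0; rewrite linearB /= (coord_simple alpha_ss) eqxx.
by apply: contraTT => /aJ->; rewrite sub0r oppr_ge0 ler10.
Qed.

Lemma Row_nonnesting J A :
  A \in nonnesting Phi alpha J -> Row alpha J A \in nonnesting Phi alpha J.
Proof. exact: rowmotion_antichains. Qed.

Lemma Row_inv_Rvac_nonnesting J A : A \in nonnesting Phi alpha J ->
  Row_inv alpha J (Rvac alpha J A) \in nonnesting Phi alpha J.
Proof.
move=> AJ; apply/rowmotion_inv_antichains/rowvacuation_antichains => //.
Qed.

Lemma nonnesting0 A : A \in nonnesting Phi alpha set0 -> A = set0.
Proof.
rewrite inE => /andP[sA _]; apply/eqP; rewrite -subset0 (subset_trans sA) //.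
apply/subsetP => x; rewrite inE => /andP[/(mem_parabolic alpha_ss) x0 _].
move/eqP: (root_nonzero Phi_rs (valP x)); case.
rewrite (root_expand alpha_ss (valP x)) big1 // => i _.
by rewrite x0 ?scale0r // inE.
Qed.

(** * Transfer through the bijections Theta *)

Variable Theta : {set 'I_r} -> {set root} -> 'M[K]_n.
Hypothesis AST : AST_family alpha L R Theta.

Lemma Theta_weyl J A : A \in nonnesting Phi alpha J -> weyl alpha J (Theta J A).
Proof. by move=> AJ; apply/noncrossing_weyl/(AST_noncrossing AST). Qed.

Lemma cox_part_L_split J' J : J' \subset J ->
  cox_part alpha (L :&: J) =
  cox_part alpha ((L :&: J) :\: J') *m cox_part alpha (L :&: J').
Proof.
move=> /setIidPr sJ; rewrite -cox_part_setU.
- by congr (cox_part alpha _); rewrite -{2}sJ setIA setUC setID.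
- rewrite (_ : _ :|: _ = L :&: J); first exact: independent_L.
  by rewrite -{2}sJ setIA setUC setID.
rewrite -setI_eq0; apply/eqP/setP => i; rewrite !inE.
by case: (i \in J'); rewrite ?andbF.
Qed.

(** [AST_parabolic] descends only to the support. It is applied to J and to J', and the indices of L
    in J outside the support are split into those outside J' and those inside. *)
Lemma Theta_sub J' J A : J' \subset J -> A \in nonnesting Phi alpha J' ->
  Theta J A = cox_part alpha ((L :&: J) :\: J') *m Theta J' A.
Proof.
move=> sJ AJ'; rewrite (AST_parabolic AST (nonnesting_sub alpha_ss sJ AJ')).
rewrite (AST_parabolic AST AJ') mulmxA -cox_part_setU.
- congr (cox_part alpha _ *m _); apply/setP => i; rewrite !(in_setU, in_setD, in_setI).
  have sS := subsetP (supp_sub AJ') i; have sJi := subsetP sJ i.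
  move: (i \in supp alpha A) (i \in J') (i \in J) (i \in L) sS sJi.
  by move=> [] [] [] [] //= sS sJi; first [by have := sJi isT|by have := sS isT].
- apply: independent_sub (bipart_left LR).
  by rewrite subUset !subDset !(subset_trans (subsetIl _ _)) ?subsetUr.
rewrite -setI_eq0; apply/eqP/setP => i; rewrite !inE.
by case: (i \in J'); rewrite ?andbF.
Qed.

(** Doubling appears because it is Krew^2 that is conjugation by c. *)
Lemma Theta_iter_Row J A m : A \in nonnesting Phi alpha J ->
  let g := iter m (mulmx (cox J)) 1%:M in
  iter m.*2 (Row alpha J) A \in nonnesting Phi alpha J /\
  Theta J (iter m.*2 (Row alpha J) A) = g *m Theta J A *m invmx g.
Proof.
move=> AJ /=; elim: m => [|m [IHJ IHm]] /=; first by rewrite mul1mx invmx1 mulmx1.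
split; first by do 2!apply: Row_nonnesting.
rewrite !(AST_equivariant AST) ?Row_nonnesting // Krew_sq; last exact: Theta_weyl.
rewrite IHm.
rewrite orthogonal_invmxM ?mulmxA //; apply: (@weyl_orthogonal J).
  exact: weyl_coxeter.
exact/weyl_iter/weyl_coxeter.
Qed.

Lemma Row_orbit_parabolic J A : J != set0 -> A \in nonnesting Phi alpha J ->
  exists k i, i \in J /\ iter k (Row alpha J) A \in nonnesting Phi alpha (J :\ i).
Proof.
move=> J0 AJ.
suff H B : B \in nonnesting Phi alpha J -> Theta J B <> cox J ->
    exists k i, i \in J /\ iter k (Row alpha J) B \in nonnesting Phi alpha (J :\ i).
  have [eA|/eqP] := eqVneq (Theta J A) (cox J); last exact: H.
  have [j jJ] := set0Pn _ J0.
  have [|k [i [iJ Hk]]] := H _ (Row_nonnesting AJ).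
    rewrite (AST_equivariant AST AJ) eA /Krew orthogonal_mulmxV.
      by move/esym; apply: coxeter_neq1 jJ.
    exact: weyl_orthogonal (weyl_coxeter L R J).
  by exists k.+1, i; rewrite iterSr.
move=> BJ nB; have [m [i [iJ Hw]]] := noncrossing_step (AST_noncrossing AST BJ) nB.
have [B2J eB2] := Theta_iter_Row m BJ.
have sJ : J :\ i \subset J by apply: subD1set.
have [B' B'J eB'] := AST_surjective AST Hw; rewrite -eB2 in eB'.
(* For i in R nothing is put in front, so [B'] is already the iterate of [B]. *)
have [iL|iNL] := boolP (i \in L); last first.
  exists m.*2, i; split=> //.
  rewrite -(_ : B' = iter m.*2 _ B) //.
  apply: (AST_injective AST) (nonnesting_sub alpha_ss sJ B'J) B2J _.
  rewrite (Theta_sub sJ B'J) eB' (_ : _ :\: _ = set0) ?cox_part0 ?mul1mx //.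
  apply/setP => k; rewrite !inE; have [->|_] /= := eqVneq k i.
    by rewrite (negPf iNL).
  by case: (k \in J); rewrite ?andbF.
(* Let w' be the conjugate of [Theta J B]. Here [Theta J B'] is s_i w', but after one Row in each
   system both values are s_i c_(J - i) w'^-1 = c_J w'^-1. *)
exists m.*2.+1, i; split=> //; rewrite iterS.
have RB'J := Row_nonnesting B'J.
rewrite -(_ : Row alpha (J :\ i) B' = Row alpha J _) //.
apply: (AST_injective AST) (nonnesting_sub alpha_ss sJ RB'J) (Row_nonnesting B2J) _.
rewrite (Theta_sub sJ RB'J) !(AST_equivariant AST) // -eB' /Krew.
have -> : (L :&: J) :\: (J :\ i) = [set i].
  apply/setP => k; rewrite !inE; have [->|_] /= := eqVneq k i; first by rewrite iL iJ.
  by case: (k \in J); rewrite ?andbF.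
by rewrite cox_part1 // mulmxA -coxeter_D1_left // inE iL.
Qed.

(** With D the part of L in J outside J', c_(L, J) = c_D c_(L, J'). Flip_J (c_D w) then contains c_D
    twice in a row, which cancels and leaves c_D Flip_(J') w. *)
Lemma Theta_Flip_restrict J' J A : J' \subset J -> A \in nonnesting Phi alpha J' ->
  Theta J' (Row_inv alpha J' (Rvac alpha J' A)) = FlipJ J' (Theta J' A) ->
  Theta J (Row_inv alpha J (Rvac alpha J A)) = FlipJ J (Theta J A).
Proof.
move=> sJ AJ' e; rewrite (Row_inv_Rvac_restrict Phi_rs alpha_ss sJ AJ').
rewrite (Theta_sub sJ (Row_inv_Rvac_nonnesting AJ')) e (Theta_sub sJ AJ') /FlipJ.
have iD : independent ((L :&: J) :\: J').
  by apply: independent_sub (@independent_L J); apply: subsetDl.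
have WD : weyl alpha J (cox_part alpha ((L :&: J) :\: J')).
  by apply: weyl_cox; apply: subset_trans (subsetDl _ _) (subsetIr _ _).
rewrite (orthogonal_invmxM (weyl_orthogonal WD) (weyl_orthogonal (Theta_weyl AJ'))).
rewrite (cox_part_inv iD) (cox_part_L_split sJ) !mulmxA.
by rewrite -(mulmxA _ (cox_part _ (_ :\: _)) (cox_part _ (_ :\: _))) cox_part_sq ?mulmx1.
Qed.

Lemma Theta_Row_inv_Rvac J A : A \in nonnesting Phi alpha J ->
  Theta J (Row_inv alpha J (Rvac alpha J A)) = FlipJ J (Theta J A).
Proof.
move: {2}#|J| (erefl #|J|) => m; elim: m J A => [|m IHm] J A cJ AJ.
  move: AJ; rewrite (cards0_eq cJ) => AJ.
  have T1 B : B \in nonnesting Phi alpha set0 -> Theta set0 B = 1%:M.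
    move/nonnesting0->; rewrite -(AST_initial AST set0); congr Theta.
    apply/setP => x; rewrite !inE; apply/esym/existsP => -[i].
    by rewrite !inE andbF.
  by rewrite /FlipJ !T1 ?Row_inv_Rvac_nonnesting // setI0 cox_part0 invmx1 !mulmx1.
have J0 : J != set0 by rewrite -card_gt0 cJ.
have [k [i [iJ Hk]]] := Row_orbit_parabolic J0 AJ.
have : Theta J (Row_inv alpha J (Rvac alpha J (iter k (Row alpha J) A))) =
    FlipJ J (Theta J (iter k (Row alpha J) A)).
  apply: (Theta_Flip_restrict _ Hk); first exact: subD1set.
  by apply: IHm => //; move: cJ; rewrite (cardsD1 i) iJ => -[].
elim: k A AJ {Hk} => // k IHk A AJ; rewrite iterSr => /(IHk _ (Row_nonnesting AJ)) e.
rewrite -(Row_inv_Rvac_dihedral Phi_rs alpha_ss AJ) (AST_equivariant AST).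
  by rewrite e (AST_equivariant AST AJ) FlipJ_Krew //; apply: Theta_weyl.
exact/Row_inv_Rvac_nonnesting/Row_nonnesting.
Qed.

(** * Flip as an automorphism of the interval *)

Lemma FlipE w : Flip alpha L w = FlipJ setT w.
Proof. by rewrite /Flip /FlipJ setIT cox_part_inv //; apply: bipart_left LR. Qed.

Lemma FlipJK J w : weyl alpha J w -> FlipJ J (FlipJ J w) = w.
Proof.
move=> Ww; have oL := weyl_orthogonal (weyl_cox_L J); have ow := weyl_orthogonal Ww.
have sL := cox_part_sq (@independent_L J).
rewrite /FlipJ !orthogonal_invmxM ?orthogonal_mxM ?orthogonal_invmx_orth // invmxK.
rewrite (cox_part_inv (@independent_L J)) !mulmxA sL mul1mx -mulmxA sL.
by rewrite mulmx1.
Qed.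

Lemma weyl_FlipJ J w : weyl alpha J w -> weyl alpha J (FlipJ J w).
Proof.
by move=> Ww; apply: weylM (weyl_cox_L J); apply: weylM (weyl_cox_L J) (weyl_inv Ww).
Qed.

Lemma abs_length_FlipJ J w k :
  abs_length Phi alpha J (FlipJ J w) k <-> abs_length Phi alpha J w k.
Proof.
rewrite /FlipJ -{2}(cox_part_inv (@independent_L J)).
exact: iff_trans (abs_length_conj _ _ (weyl_cox_L J)) (abs_length_inv _ _ _).
Qed.

Lemma abs_le_FlipJ J u w : weyl alpha J u -> weyl alpha J w ->
  abs_le Phi alpha J u w -> abs_le Phi alpha J (FlipJ J u) (FlipJ J w).
Proof.
move=> Wu Ww [k [l [lu luw lw]]]; exists k, l; split; try exact/abs_length_FlipJ.
have oL := weyl_orthogonal (weyl_cox_L J).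
have ou := weyl_orthogonal Wu; have ow := weyl_orthogonal Ww.
have uu := orthogonal_unitmx ou.
have sL := cox_part_sq (@independent_L J).
(* (Flip u)^-1 Flip w = c_L u w^-1 c_L is conjugate to (u^-1 w)^-1. *)
suff -> : invmx (FlipJ J u) *m FlipJ J w = FlipJ J (u *m (invmx u *m w) *m invmx u).
  by apply/abs_length_FlipJ/abs_length_conj.
rewrite /FlipJ mulKVmx //.
rewrite !orthogonal_invmxM ?orthogonal_mxM ?orthogonal_invmx_orth // invmxK.
rewrite (cox_part_inv (@independent_L J)) !mulmxA.
by rewrite -(mulmxA _ (cox_part _ _) (cox_part _ _)) sL mulmx1.
Qed.

Lemma FlipJ_coxeter J : FlipJ J (cox J) = cox J.
Proof.
by rewrite /FlipJ coxeter_inv -!mulmxA (cox_part_sq (@independent_L J)) mulmx1.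
Qed.

Lemma FlipJ1 J : FlipJ J 1%:M = 1%:M.
Proof. by rewrite /FlipJ invmx1 mulmx1 cox_part_sq //; apply: independent_L. Qed.

(** Flip preserves absolute order and fixes both ends e and c of the interval. *)
Lemma noncrossing_FlipJ J w :
  noncrossing Phi alpha L R J w -> noncrossing Phi alpha L R J (FlipJ J w).
Proof.
case=> Ww w1 wc; split; first exact: weyl_FlipJ.
  by rewrite -(FlipJ1 J); apply: abs_le_FlipJ w1 => //; apply: weyl1.
by rewrite -(FlipJ_coxeter J); apply: abs_le_FlipJ wc => //; apply: weyl_coxeter.
Qed.

Lemma FlipJ_involutive_poset_automorphism J :
  involutive_poset_automorphism (noncrossing Phi alpha L R J)
    (abs_le Phi alpha J) (FlipJ J).
Proof.
split=> [w|w /noncrossing_weyl|u w /noncrossing_weyl Wu /noncrossing_weyl Ww].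
- exact: noncrossing_FlipJ.
- exact: FlipJK.
split; first exact: abs_le_FlipJ.
move/(abs_le_FlipJ (weyl_FlipJ Wu) (weyl_FlipJ Ww)).
by rewrite !FlipJK.
Qed.

End Weyl.

Theorem theorem1p5 (K : archiRealFieldType) (n r : nat)
    (Phi : seq 'cV[K]_n) (alpha : r.-tuple 'cV[K]_n)
    (L R : {set 'I_r})
    (Theta : {set 'I_r} -> {set seq_sub Phi} -> 'M[K]_n)
    (Phi_root_system : root_system Phi)
    (alpha_simple : simple_system Phi alpha)
    (LR_bipartition : dynkin_bipartition alpha L R)
    (Theta_AST : AST_family alpha L R Theta) :
  involutive_poset_automorphism
    (noncrossing Phi alpha L R setT) (abs_le Phi alpha setT) (Flip alpha L) /\
  (forall A : {set seq_sub Phi}, A \in nonnesting Phi alpha setT ->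
    Theta setT (Row_inv alpha setT (Rvac alpha setT A)) =
      Flip alpha L (Theta setT A)).
Proof.
split=> [|A AP].
  have [H1 H2 H3] := FlipJ_involutive_poset_automorphism Phi_root_system
    alpha_simple LR_bipartition setT.
  have E := FlipE LR_bipartition.
  split=> [w|w|u w]; rewrite ?E; [exact: H1|exact: H2|exact: H3].
rewrite (FlipE LR_bipartition).
exact: (Theta_Row_inv_Rvac Phi_root_system alpha_simple LR_bipartition Theta_AST).
Qed.
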